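(* The only self-homeomorphisms of the Golomb space $G(\mathbb{Z})$ (i.e., homeomorphisms $G(\mathbb{Z})\to G(\mathbb{Z})$) are the identity and the multiplication by $-1$.
   Context: For an integral domain $R$, set $R^\bullet:=R\setminus\{0\}$. The Golomb space $G(R)$ is the set $R^\bullet$ endowed with the topology generated by the cosets $a+I$, where $a\in R$ and $I$ is a nonzero ideal of $R$ such that $\langle a,I\rangle=R$. *)

(* Defs.v *)
From HB Require Import structures.
From mathcomp Require Import all_boot all_order all_algebra.
From mathcomp Require Import classical_sets boolp topology.

Set Implicit Arguments.
Unset Strict Implicit.
Unset Printing Implicit Defensive.

Import GRing.Theory.

Local Open Scope classical_set_scope.
Local Open Scope ring_scope.

(* The library's [idealr] is restricted to decidable proper ideals; here the
   unit ideal is an ideal too. *)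
Definition is_ideal (R : idomainType) (I : set R) : Prop :=
  [/\ I 0, (forall x y, I x -> I y -> I (x + y))
    & (forall r x, I x -> I (r * x))].

Definition ideal_gen (R : idomainType) (A : set R) : set R :=
  smallest (@is_ideal R) A.

Definition coset (R : idomainType) (a : R) (I : set R) : set R :=
  [set a + x | x in I].

Definition golomb (R : idomainType) : Type := {x : R | x != 0}.

HB.instance Definition _ (R : idomainType) :=
  SubChoice.copy (golomb R) {x : R | x != 0}.

(* Cosets are intersected with the nonzero elements: a + I contains 0 only when
   I is the whole ring, in which case the trace is the whole space. *)
Definition golomb_subbase (R : idomainType) : set (set (golomb R)) :=
  [set U | exists a (I : set R),
    [/\ is_ideal I, I <> [set 0], ideal_gen (a |` I) = [set: R]
      & U = [set x : golomb R | coset a I (val x)]]].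

HB.instance Definition _ (R : idomainType) :=
  @isSubBaseTopological.Build (golomb R) (set (golomb R))
    (@golomb_subbase R) id.

Definition homeomorphism (S T : topologicalType) (f : S -> T) : Prop :=
  continuous f /\
  exists g : T -> S, [/\ cancel f g, cancel g f & continuous g].

(* Main.v *)
Require Import Defs.
From mathcomp Require Import all_boot all_order all_algebra.
From mathcomp Require Import classical_sets boolp topology.
From mathcomp Require Import cyclic zify ring.

(** A self-homeomorphism [f] of the Golomb space of the integers is pinned down
by the arithmetic that the topology remembers: the prime divisors of a point,
the [p]-adic topology away from [p], and how close a point is to [1] or [-1]
modulo powers of [p].

Supports.  A point [z] lies in the closure of [x + nZ] iff, for every prime
power [p ^ k] dividing [n], either [p] divides [z] or [z = x] modulo [p ^ k]
([closure_progressionP]).  Hence, for two distinct points [x] and [y], the sets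
[closure U `&` closure V], with [U] a neighbourhood of [x] and [V] one of [y],
record which of the two points each prime divides.  Comparing such families of
sets ([refines]) shows that [f] maps units to units and preserves inclusion
between sets of prime divisors.  Primes are the minimal
non-units for this preorder, so there is a bijection between primes, written
[prime_match f p p'], such that [p] divides [x] iff [p'] divides [f x]
([exists_prime_match]).

Topologies at a prime.  Among the numbers prime to [p], complementary relatively
clopen sets cannot contain points that are too close [p]-adically: some number
close to both at [p], and divisible by the other primes in play, would lie in
both closures.  So relatively clopen sets are [p]-adically open
([relclopen_padic]) and [f] transports [p]-adic closures ([set_match_padic]).

Levels.  The [p]-adic closure of the numbers with only prime divisor [q] is the
trace on [Z] of the closed subgroup generated by [q] and [-1] in the units of
[Z_p] ([padic_group]).  Modulo [-1] these units form a procyclic group, in which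
the congruence subgroups [near1 p k], made of the [x] equal to [1] or [-1] modulo
[p ^ k], form a chain.  They are characterised among the groups [padic_group p q]
as those below which everything is linearly ordered ([near1_chainlike],
[chainlike_near1]).  This needs enough subgroups: every [near1 p k] is some
[padic_group p q] ([exists_padic_group_near1], by factoring values of cyclotomic
polynomials), and the subgroup generated by the powers of [q ^ p] is reached
through an auxiliary prime modulo which [q] has order [p].  Since strictly decreasing sequences of type
omega have only one order isomorphism, [f] maps the levels at [p] to the levels
at [p'], one by one ([near1_match_level]).

Conclusion.  Levels at [p] are the powers of [p] dividing [x ^ 2 - 1], up to a
shift at [p = 2].  The prime [2] is its own image ([prime_match2]); for an odd
prime [p], all prime divisors of [p ^ 2 - 1] are smaller than [p], so by strong
induction [p ^ 2 - 1] and [f p ^ 2 - 1] have the same valuations, [f p] is [p] or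
[- p], and [p] is its own image as well ([prime_match_refl]).  The same comparison
then gives [f x = x] or [f x = - x] for each [x], and the sign does not depend
on [x] because the space is connected ([clopen_setT]). *)

Set Implicit Arguments.
Unset Strict Implicit.
Unset Printing Implicit Defensive.

Import Order.TTheory GRing.Theory Num.Theory.

Local Open Scope classical_set_scope.
Local Open Scope ring_scope.

Local Notation "n %|| x" := (x%R \in dvdz (Posz n%N)) (at level 70).
Local Notation GZ := (golomb int).

(** * Density of powers in congruence subgroups *)

(** The first level from which raising to the power [p] raises the level by
exactly one; for [p = 2] this fails at level [1]. *)
Definition base_level (p : nat) : nat := (p == 2).+1.

Definition near1 (p k : nat) (x : int) : bool :=
  ((p ^ k)%N %|| x - 1) || ((p ^ k)%N %|| x + 1).

(** Closure in the [p]-adic topology of the integers prime to [p]. *)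
Definition padic_closure (p : nat) (A : set int) : set int :=
  [set x | ~~ (p %|| x) /\ forall n, exists2 a, A a & (p ^ n)%N %|| a - x].

Lemma PoszX (m n : nat) : (m ^ n)%N%:Z = m%:Z ^+ n.
Proof. by rewrite -natz natrX natz. Qed.

Lemma dvdz_expE (p k : nat) (x : int) :
  ((p ^ k)%N %|| x) = (p%:Z ^+ k %| x)%Z.
Proof. by rewrite PoszX. Qed.

Lemma near1N p k x : near1 p k (- x) = near1 p k x.
Proof.
by rewrite /near1 -opprD rpredN [- x + 1]addrC -opprB rpredN orbC.
Qed.

Lemma expr1D_quadratic (a : int) t : exists w,
  (1 + a) ^+ t = 1 + t%:Z * a + 'C(t, 2)%:Z * a ^+ 2 + a ^+ 3 * w.
Proof.
elim: t => [|t [w IH]]; first by exists 0; rewrite expr0 bin0n /= !mul0r mulr0 !addr0.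
exists ('C(t, 2)%:Z + (1 + a) * w).
by rewrite exprS IH binS bin1 PoszD intS; ring.
Qed.

(** In the binomial expansion of [(1 + u * p ^ k) ^ p], the linear term has
valuation [k + 1] and all later ones have a larger valuation.  For the quadratic
term this uses [p] odd or [2 <= k]. *)
Lemma level_pow_prime p k (g : int) : prime p -> (base_level p <= k)%N ->
  (p ^ k)%N %|| g - 1 -> ~~ ((p ^ k.+1)%N %|| g - 1) ->
  (p ^ k.+1)%N %|| g ^+ p - 1 /\ ~~ ((p ^ k.+2)%N %|| g ^+ p - 1).
Proof.
move=> pp hk; rewrite !dvdz_expE => /dvdzP[u eu].
have {eu}-> : g = 1 + u * p%:Z ^+ k by rewrite -eu; ring.
have p0 : p%:Z != 0 by have := prime_gt0 pp; lia.
rewrite [1 + _ - 1]addrC addKr exprS dvdz_mul2r ?expf_neq0 // => pu.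
have [w ->] := expr1D_quadratic (u * p%:Z ^+ k) p.
have [v ->] : exists v, 1 + p%:Z * (u * p%:Z ^+ k)
   + 'C(p, 2)%:Z * (u * p%:Z ^+ k) ^+ 2 + (u * p%:Z ^+ k) ^+ 3 * w
   = 1 + (u + p%:Z * v) * p%:Z ^+ k.+1.
  move: hk; rewrite /base_level; case: eqP => [->|/eqP p2].
    case: k {pu} => [|[|k]] // _; exists (2%:Z ^+ k * u ^+ 2
        + (2%:Z ^+ k) ^+ 2 * 2 * 2 * u ^+ 3 * w).
    by rewrite binn !exprS; ring.
  case: k {pu} => [|k] // _.
  have /dvdnP[c ->] : (p %| 'C(p, 2))%N.
    by apply: prime_dvd_bin => //; move/eqP: p2; have := prime_gt1 pp; lia.
  exists (c%:Z * p%:Z ^+ k * u ^+ 2 + (p%:Z ^+ k) ^+ 2 * u ^+ 3 * w).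
  by rewrite PoszM !exprS; ring.
rewrite [1 + _ - 1]addrC addKr -exprS dvdz_mull //; split=> //.
rewrite [p%:Z ^+ k.+2]exprS dvdz_mul2r ?expf_neq0 //.
by rewrite rpredDr // dvdz_mulr.
Qed.

Lemma level_pow_iter p k (g : int) i : prime p -> (base_level p <= k)%N ->
  (p ^ k)%N %|| g - 1 -> ~~ ((p ^ k.+1)%N %|| g - 1) ->
  (p ^ (k + i))%N %|| g ^+ (p ^ i) - 1 /\
  ~~ ((p ^ (k + i).+1)%N %|| g ^+ (p ^ i) - 1).
Proof.
move=> pp hk h1 h2; elim: i => [|i [IH1 IH2]]; first by rewrite addn0 expr1.
rewrite addnS expnSr exprM; apply: level_pow_prime => //.
by rewrite (leq_trans hk) ?leq_addr.
Qed.

(** The computation behind one step of the Hensel-type lifting in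
[powers_dense]: [t = c * q - y * b] cancels the error term [y] modulo [q]. *)
Lemma lift_step (a b c y G u P C q w : int) : a * q + b * (G * u) = 1 ->
  G * (1 + (- (y * b) + c * q) * (u * (q * P)) + C * (u * (q * P)) ^+ 2
       + (u * (q * P)) ^+ 3 * w) - (G - y * (q * P))
  = (y * a + G * u * c + G * C * u ^+ 2 * P + G * u ^+ 3 * P ^+ 2 * q * w)
    * (q * (q * P)).
Proof.
move=> e; apply/eqP; rewrite -subr_eq0; apply/eqP.
transitivity (y * P * q * (1 - (a * q + b * (G * u)))); first by ring.
by rewrite e; ring.
Qed.

(** An element of exact level [k] topologically generates the congruence
subgroup of level [k].  Successive approximation: if [g ^ m.+1] agrees with [x]
modulo [p ^ (k + i)], multiplying by a suitable power of [g ^ (p ^ i)], which has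
exact level [k + i], improves the agreement by one more power of [p]. *)
Lemma powers_dense p k (g x : int) n : prime p -> (base_level p <= k)%N ->
  (p ^ k)%N %|| g - 1 -> ~~ ((p ^ k.+1)%N %|| g - 1) ->
  (p ^ k)%N %|| x - 1 -> exists m, (p ^ n)%N %|| g ^+ m.+1 - x.
Proof.
move=> pp hk h1 h2 hx.
have p0 : p%:Z != 0 by have := prime_gt0 pp; lia.
have k0 : (0 < k)%N by apply: leq_trans hk.
have pg : ~~ (p %|| g).
  apply/negP => pg; have pg1 : p %|| g - 1.
    by apply: dvdz_trans h1; rewrite dvdzE /= dvdn_exp.
  have := rpredB pg pg1; rewrite subKr dvdzE /= dvdn1 => /eqP p1.
  by rewrite p1 in pp.
suff H i : exists m, (p ^ (k + i))%N %|| g ^+ m.+1 - x.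
  have [m hm] := H n; exists m; apply: dvdz_trans hm.
  by rewrite dvdzE /= dvdn_exp2l // leq_addl.
elim: i => [|i [m IH]].
  exists 0%N; rewrite addn0 expr1 -(subrK 1 g) -addrA rpredD //.
  by rewrite -opprB rpredN.
have [] := level_pow_iter i pp hk h1 h2; move: IH.
rewrite !dvdz_expE => /dvdzP[y ey] /dvdzP[u eu].
rewrite eu exprS dvdz_mul2r ?expf_neq0 // => pu.
(* solve [y + g^(m+1) u t = 0 mod p] for [t] *)
have cop : coprimez (p%:Z) (g ^+ m.+1 * u).
  rewrite coprimezE /= prime_coprime // abszM abszX Euclid_dvdM //.
  by rewrite Euclid_dvdX // negb_or negb_and pg.
have [[a b] /= eab] := coprimezP _ _ cop.
pose t := `|(- (y * b) %% p)%Z|%N.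
have et : exists c, t%:Z = - (y * b) + c * p%:Z.
  exists (- (- (y * b) %/ p)%Z).
  rewrite /t gez0_abs ?modz_ge0 //.
  by rewrite {2}(divz_eq (- (y * b)) p); ring.
exists (m + p ^ i * t)%N.
rewrite -addSn exprD exprM.
have {eu}-> : g ^+ (p ^ i) = 1 + u * p%:Z ^+ (k + i) by rewrite -eu; ring.
have [w ->] := expr1D_quadratic (u * p%:Z ^+ (k + i)) t.
have {ey}-> : x = g ^+ m.+1 - y * p%:Z ^+ (k + i) by rewrite -ey; ring.
have [c ->] := et; rewrite addnS.
have [l ->] : exists l, (k + i = l.+1)%N.
  by exists (k + i).-1; rewrite prednK // addn_gt0 k0.
move: (g ^+ m.+1) eab => G eab; rewrite dvdz_expE (exprS _ l.+1) (exprS _ l).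
apply/dvdzP; exists (y * a + G * u * c + G * 'C(t, 2)%:Z * u ^+ 2 * p%:Z ^+ l
  + G * u ^+ 3 * (p%:Z ^+ l) ^+ 2 * p%:Z * w).
exact: lift_step.
Qed.

Lemma dvdz_exp_le p j k (x : int) : (j <= k)%N ->
  (p ^ k)%N %|| x -> (p ^ j)%N %|| x.
Proof. by move=> jk; apply: dvdz_trans; rewrite dvdzE dvdn_exp2l. Qed.

Lemma near1_le p j k x : (j <= k)%N -> near1 p k x -> near1 p j x.
Proof.
by move=> jk /orP[] /(dvdz_exp_le jk) h; apply/orP; [left|right].
Qed.

Lemma near1M p k x y : near1 p k x -> near1 p k y -> near1 p k (x * y).
Proof.
wlog hx : x y / (p ^ k)%N %|| x - 1.
  move=> H /orP[hx hy|hx hy]; first by apply: H => //; apply/orP; left.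
  rewrite -near1N -mulNr; apply: H => //; first by rewrite -opprD rpredN.
  by rewrite near1N; apply/orP; right.
move=> _ /orP[] hy; apply/orP; [left|right].
  have -> : x * y - 1 = (x - 1) * y + (y - 1) by ring.
  by rewrite rpredD // dvdz_mulr.
have -> : x * y + 1 = (x - 1) * y + (y + 1) by ring.
by rewrite rpredD // dvdz_mulr.
Qed.

Lemma near1_1 p k : near1 p k 1.
Proof. by rewrite /near1 subrr dvdz0. Qed.

Lemma near1X p k x m : near1 p k x -> near1 p k (x ^+ m).
Proof.
move=> hx; elim: m => [|m IH]; first by rewrite expr0 near1_1.
by rewrite exprS near1M.
Qed.

Lemma near1_congr p k (x y : int) : (p ^ k)%N %|| y - x ->
  near1 p k x -> near1 p k y.
Proof.
move=> h /orP[] hx; apply/orP; [left|right].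
  by rewrite -(subrK x y) -addrA rpredD.
by rewrite -(subrK x y) -addrA rpredD.
Qed.

Lemma near1_unbounded p (x : int) : (1 < p)%N -> x != 1 -> x != -1 ->
  exists k, ~~ near1 p k x.
Proof.
move=> p1 x1 xN1; exists `|x|.+2%N.
have lt := ltn_expl `|x|.+2%N p1.
by apply/norP; split; rewrite dvdzE /=; apply/negP => /dvdn_leq; lia.
Qed.

Lemma near1_ndvd p k (x : int) : prime p -> (0 < k)%N -> near1 p k x ->
  ~~ (p %|| x).
Proof.
move=> pp k0 hx; apply/negP => px.
have := near1_le k0 hx; rewrite /near1 expn1 => /orP[] h.
  by have := rpredB px h; rewrite subKr dvdzE /= dvdn1 => /eqP p1; rewrite p1 in pp.
by have := rpredB h px; rewrite addrC addKr dvdzE /= dvdn1 => /eqP p1; rewrite p1 in pp.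
Qed.

Lemma base_level_gt0 p : (0 < base_level p)%N. Proof. by []. Qed.

Lemma padic_closureS p (A B : set int) : A `<=` B ->
  padic_closure p A `<=` padic_closure p B.
Proof.
by move=> AB x [px H]; split=> // n; have [a /AB] := H n; exists a.
Qed.

Lemma padic_closure_level p k (A : set int) (g : int) : prime p ->
    (base_level p <= k)%N -> (forall x m, A x -> A (x ^+ m.+1)) ->
    (forall x, A x -> A (- x)) -> (forall x, A x -> near1 p k x) ->
    A g -> ~~ near1 p k.+1 g ->
  padic_closure p A = [set x | near1 p k x].
Proof.
move=> pp hk AX AN AU.
wlog g1 : g / (p ^ k)%N %|| g - 1.
  move=> H Ag gN; have /orP[] := AU _ Ag; first by move=> ?; apply: (H g).
  move=> h; apply: (H (- g)); last by rewrite near1N.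
    by rewrite -opprD rpredN.
  exact: AN.
move=> Ag /norP[gN _]; rewrite predeqE => x; split=> /=.
  by move=> [_ /(_ k)[a /AU ha]]; rewrite -opprB rpredN => /near1_congr; apply.
move=> hx; split; first exact: (near1_ndvd pp (leq_trans _ hk) hx).
move=> n; have /orP[] := hx => {}hx.
  have [m hm] := powers_dense n pp hk g1 gN hx.
  by exists (g ^+ m.+1) => //; apply: AX.
have {}hx : (p ^ k)%N %|| - x - 1 by rewrite -opprD rpredN.
have [m hm] := powers_dense n pp hk g1 gN hx.
exists (- g ^+ m.+1); first by apply/AN/AX.
by rewrite -opprD rpredN -[x]opprK.
Qed.

(** The closure only depends on the smallest level attained in [A], by
[powers_dense]. *)
Lemma padic_closure_near1 p (A : set int) (g : int) : prime p ->
    (forall x m, A x -> A (x ^+ m.+1)) ->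
    (forall x, A x -> A (- x)) -> (forall x, A x -> near1 p (base_level p) x) ->
    A g -> g != 1 -> g != -1 ->
  exists2 k, (base_level p <= k)%N & padic_closure p A = [set x | near1 p k x].
Proof.
move=> pp AX AN AU Ag g1 gN1.
have [k0 hk0] := near1_unbounded (prime_gt1 pp) g1 gN1.
pose P k := `[< (base_level p <= k)%N /\ exists2 x, A x & ~~ near1 p k.+1 x >].
have exP : exists k, P k.
  exists (maxn (base_level p) k0); apply/asboolP; split; first exact: leq_maxl.
  exists g => //; apply: contra hk0; apply: near1_le.
  exact: leq_trans (leq_maxr _ _) (leqnSn _).
case: (ex_minnP exP) => k /asboolP[hk [x Ax xk]] mink; exists k => //.
apply: (padic_closure_level pp hk AX AN _ Ax xk) => y Ay.
have [ek|ltk] := eqVneq k (base_level p); first by rewrite ek; apply: AU.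
apply: contraT => yk.
have : (k <= k.-1)%N.
  apply: mink; apply/asboolP; split; first by move: ltk hk; lia.
  by exists y => //; rewrite prednK //; exact: leq_trans hk.
by move: hk; rewrite /base_level; lia.
Qed.

(** * Primes of prescribed level *)

Lemma dvdz_exp_gcd (d : nat) (a : int) m n : d %|| a ^+ m - 1 ->
  d %|| a ^+ n - 1 -> d %|| a ^+ gcdn m n - 1.
Proof.
have [->|m0] := posnP m; first by rewrite gcd0n.
move=> hm hn; case: (egcdnP n m0) => u v e _.
have hX c i : d %|| a ^+ i - 1 -> d %|| a ^+ (c * i) - 1.
  by move=> h; rewrite mulnC exprM subrX1 dvdz_mulr.
have /(hX u) := hm; rewrite e exprD.
have /(hX v) := hn; move: (a ^+ (v * n)) (a ^+ gcdn m n) => b c hb hc.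
have -> : c - 1 = (b * c - 1) - (b - 1) * c by ring.
by rewrite rpredB // dvdz_mulr.
Qed.

Lemma fermatz (r : nat) (a : int) : prime r -> ~~ (r %|| a) ->
  r %|| a ^+ r.-1 - 1.
Proof.
move=> pr ra; have r0 := prime_gt0 pr.
have h : r %|| a * (a ^+ r.-1 - 1).
  rewrite mulrBr mulr1 -exprS prednK // -eqz_mod_dvd.
  have e : (a = `|(a %% r)%Z|%N%:Z %[mod r])%Z.
    by rewrite gez0_abs ?modz_ge0 ?modz_mod //; lia.
  set b := `|(a %% r)%Z|%N in e.
  have := fermat_little b pr => /eqP; rewrite -eqz_nat -!modz_nat => /eqP f.
  apply/eqP; by rewrite e -f PoszX -modzXm -e modzXm.
by move: h; rewrite dvdzE abszM Euclid_dvdM // -[(r %| `|a|)%N]/(r %|| a) (negPf ra).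
Qed.

(** The order of [a] modulo [r] is exactly [p ^ k.+1], and it divides [r - 1]
by Fermat's little theorem. *)
Lemma prime_order p r k (a : int) : prime p -> prime r ->
  r %|| a ^+ (p ^ k.+1) - 1 -> ~~ (r %|| a ^+ (p ^ k) - 1) ->
  (p ^ k.+1)%N %|| r%:Z - 1.
Proof.
move=> pp pr h1 h2; have r1 := prime_gt1 pr.
have ra : ~~ (r %|| a).
  apply/negP => ra; have : r %|| a ^+ (p ^ k.+1) by rewrite dvdz_exp // expn_gt0 prime_gt0.
  move=> /rpredB /(_ h1); rewrite subKr dvdzE /= dvdn1 => /eqP er; move: pr.
  by rewrite er.
have h := dvdz_exp_gcd h1 (fermatz pr ra).
have -> : r%:Z - 1 = r.-1%:Z by rewrite predn_int // ltnW.
have := dvdn_gcdl (p ^ k.+1) r.-1; move/(dvdn_pfactor _ _ pp) => [i ik eg].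
have := dvdn_gcdr (p ^ k.+1) r.-1; rewrite eg; move: ik.
rewrite leq_eqVlt ltnS => /orP[/eqP-> //|ik] _.
case/negP: h2; rewrite -(subnK ik) expnD mulnC exprM -eg subrX1.
by rewrite dvdz_mulr.
Qed.

Lemma dvdz_prime_ind d N : (0 < N)%N ->
  (forall r, prime r -> (r %| N)%N -> d %|| r%:Z - 1) -> d %|| N%:Z - 1.
Proof.
elim/ltn_ind: N => N IH N0 H.
have [->|N1] := eqVneq N 1%N; first by rewrite subrr dvdz0.
have pr : prime (pdiv N) by rewrite pdiv_prime //; lia.
have /dvdnP[M eM] := pdiv_dvd N.
have := H _ pr (pdiv_dvd N); have := prime_gt1 pr.
move: (pdiv N) eM => r eM r1 hr.
have M0 : (0 < M)%N by move: N0; rewrite eM; case: M {eM}.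
have hM : d %|| M%:Z - 1.
  apply: IH => //; first by rewrite eM; nia.
  by move=> s ps sM; apply: H => //; rewrite eM dvdn_mulr.
have -> : N%:Z - 1 = (M%:Z - 1) * r%:Z + (r%:Z - 1) by rewrite eM PoszM; ring.
by rewrite rpredD // dvdz_mulr.
Qed.

Lemma base_level_ndvd2 p k : prime p -> (base_level p <= k)%N ->
  ~~ ((p ^ k)%N %|| 2).
Proof.
move=> pp; rewrite /base_level; case: eqP => [->|p2] hk; apply/negP.
  by move=> /(dvdz_exp_le hk); rewrite dvdzE.
move=> /(dvdz_exp_le hk); rewrite expn1 dvdzE /= => /dvdn_leq.
by have := prime_gt1 pp; lia.
Qed.

(** If every prime divisor of [N] had level at least [k + 1], so would [N]:
since the prime divisors are [1] modulo [p ^ k], no sign ambiguity arises. *)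
Lemma exists_prime_level_of p k N : prime p -> (base_level p <= k)%N ->
    (0 < N)%N -> (forall r, prime r -> (r %| N)%N -> (p ^ k)%N %|| r%:Z - 1) ->
    ~~ ((p ^ k.+1)%N %|| N%:Z - 1) ->
  exists r, [/\ prime r, near1 p k r%:Z & ~~ near1 p k.+1 r%:Z].
Proof.
move=> pp hk N0 H hN; apply: contrapT => nex; case/negP: hN.
apply: dvdz_prime_ind => // r pr rN.
have hr := H r pr rN.
have : near1 p k.+1 r%:Z.
  by apply: contraT => h; case: nex; exists r; split=> //; apply/orP; left.
case/orP=> // /(dvdz_exp_le (leqnSn k)) h.
case/negP: (base_level_ndvd2 pp hk); have := rpredB h hr.
by have -> : r%:Z + 1 - (r%:Z - 1) = 2 by ring.
Qed.

(** The number [N = (3 ^ (2 ^ k.+1) + 1) / 2] has exact level [k + 2], and modulo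
each of its prime divisors [3] has order [2 ^ k.+2]. *)
Lemma exists_prime_level2 k :
  exists r, [/\ prime r, near1 2 k.+2 r%:Z & ~~ near1 2 k.+3 r%:Z].
Proof.
have [a ea] : exists a : int, a = 3 ^+ 2 by exists (3 ^+ 2).
have [//|//|||] := @level_pow_iter 2 3 a k; try by rewrite ea.
rewrite !dvdz_expE !add3n => /dvdzP[c ec]; rewrite ec (exprS _ k.+3).
rewrite dvdz_mul2r ?expf_neq0 // => c2.
have c0 : 0 <= c.
  have : 0 <= a ^+ (2 ^ k) - 1 by rewrite subr_ge0 exprn_ege1 // ea.
  by rewrite ec pmulr_lge0 // exprn_gt0.
have P0 : 0 < 2 ^+ k.+2 :> int by rewrite exprn_gt0.
have [N eN] : exists N : nat, N%:Z = 1 + c * 2 ^+ k.+2.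
  by exists (absz (1 + c * 2 ^+ k.+2)); rewrite gez0_abs // addr_ge0 // mulr_ge0 // ltW.
have e2 : a ^+ (2 ^ k) + 1 = N%:Z * 2.
  by rewrite eN -[a ^+ _](subrK 1) ec exprS; ring.
have N0 : (0 < N)%N.
  by rewrite -ltz_nat eN ltr_wpDr // mulr_ge0 // ltW.
apply: (@exists_prime_level_of 2 k.+2 N) => //; last first.
  by rewrite dvdz_expE eN addrC addKr exprS dvdz_mul2r // gt_eqF.
move=> r pr rN; have rNz : r %|| N%:Z by [].
apply: (@prime_order _ _ _ 3) => //.
  rewrite expnSr exprM expnS exprM -ea.
  rewrite -[X in _ - X](expr1n _ 2) subr_sqr e2.
  by rewrite dvdz_mull // dvdz_mulr.
apply/negP; rewrite expnS exprM -ea => hr.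
have : r %|| 2.
  have := rpredB (dvdz_mulr 2 rNz) hr.
  by have -> : N%:Z * 2 - (a ^+ (2 ^ k) - 1) = 2 by rewrite -e2; ring.
rewrite dvdzE /= dvdn_prime2 // => /eqP er; move: rNz; rewrite er eN.
rewrite rpredDr ?dvdz1 // exprS mulrCA dvdz_mulr //.
Qed.

(** For odd [p], the cyclotomic value [N = (b ^ p - 1) / (b - 1)] with
[b = (p - 1) ^ (p ^ k)] does the job at level [k + 1].  Modulo a prime divisor of
[N] the order of [p - 1] is [p ^ k.+1].  Moreover [N] does not have level [k + 2],
because [b = - h] with [h = (1 - p) ^ (p ^ k)] of exact level [k + 1], while
[(h + 1) * N = h ^ p + 1] and [h ^ p = 1] modulo [p ^ (k + 2)]. *)
Lemma exists_prime_level p k : prime p -> (base_level p <= k)%N ->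
  exists r, [/\ prime r, near1 p k r%:Z & ~~ near1 p k.+1 r%:Z].
Proof.
move=> pp hk; have [p2|p2] := eqVneq p 2%N.
  move: hk; rewrite p2 /base_level eqxx.
  by case: k => [|[|k]] // _; apply: exists_prime_level2.
have bp : base_level p = 1%N by rewrite /base_level (negPf p2).
case: k hk => [|k _]; first by rewrite bp.
have p0 := prime_gt0 pp.
have pz : p%:Z != 0 by lia.
have n2 : ~~ (p %|| 2).
  by rewrite -(expn1 p); apply: base_level_ndvd2; rewrite ?bp.
have hk1 : (base_level p <= 1 + k)%N by rewrite bp.
have [|||h1 h2] := @level_pow_iter p 1 (1 - p%:Z) k pp.
- by rewrite bp.
- by rewrite addrC addKr rpredN.
- rewrite addrC addKr rpredN dvdzE /=; apply/negP => /dvdn_leq => /(_ p0).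
  by have := prime_gt1 pp; nia.
set h := (1 - p%:Z) ^+ (p ^ k) in h1 h2.
have [h3 _] := level_pow_prime pp hk1 h1 h2.
rewrite !add1n in h1 h2 h3.
pose b := (p.-1 ^ (p ^ k))%N.
have podd : odd p by case: (even_prime pp) p2 => // ->.
have eb : b%:Z = - h.
  rewrite /b PoszX predn_int // /h -opprB.
  by rewrite exprNn -signr_odd oddX podd orbT expr1 mulN1r.
have n2k : ~~ ((p ^ k.+1)%N %|| 2) by apply: base_level_ndvd2.
pose N := (\sum_(i < p) b ^ i)%N.
have eN : (b%:Z - 1) * N%:Z = b%:Z ^+ p - 1.
  rewrite subrX1; congr (_ * _); rewrite /N -natz raddf_sum /=.
  by apply: eq_bigr => i _; rewrite natz PoszX.
have ebp : b%:Z ^+ p = - h ^+ p.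
  by rewrite eb exprNn -signr_odd podd expr1 mulN1r.
have e1 : (h + 1) * N%:Z = h ^+ p + 1.
  by move: eN; rewrite ebp eb => e; apply: oppr_inj; rewrite opprD -e; ring.
have pN : ~~ (p %|| N%:Z).
  apply/negP => pN; case/negP: n2.
  have h3' : p %|| h ^+ p - 1 by rewrite -(expn1 p); apply: dvdz_exp_le h3.
  have := rpredB (dvdz_mull (h + 1) pN) h3'; rewrite e1.
  by have -> : h ^+ p + 1 - (h ^+ p - 1) = 2 by ring.
have N0 : (0 < N)%N by rewrite lt0n; apply: contraNneq pN => ->; apply: dvdz0.
apply: (@exists_prime_level_of p k.+1 N) => //.
  move=> r pr rN; have rNz : r %|| N%:Z by [].
  have hbp : r %|| b%:Z ^+ p - 1 by rewrite -eN dvdz_mull.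
  apply: (@prime_order _ _ _ p.-1%:Z) => //.
    by rewrite expnSr exprM -PoszX.
  rewrite -PoszX -/b; apply/negP => hb1.
  have hbi i : r %|| b%:Z ^+ i - 1 by rewrite subrX1 dvdz_mulr.
  have : r %|| N%:Z - p%:Z.
    have -> : N%:Z - p%:Z = \sum_(i < p) (b%:Z ^+ i - 1).
      rewrite sumrB sumr_const card_ord natz; congr (_ - _).
      rewrite /N -natz raddf_sum /=.
      by apply: eq_bigr => i _; rewrite natz PoszX.
    by apply: rpred_sum => i _.
  move=> /(rpredB rNz); rewrite subKr dvdzE /= dvdn_prime2 // => /eqP er.
  by rewrite -er rNz in pN.
apply/negP => hN; case/negP: h2.
have := rpredB h3 (dvdz_mull (h + 1) hN).
have -> : h ^+ p - 1 - (h + 1) * (N%:Z - 1) = h - 1.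
  by rewrite mulrBr e1; ring.
by [].
Qed.

(** * Subgroups generated by a prime *)

(** The numbers [q ^ m] and [- q ^ m] with [0 < m] when [q] is prime
([prime_powersE]), in a form that refers to divisibility by primes only: this is
what homeomorphisms are known to respect. *)
Definition prime_powers (q : nat) : set int :=
  [set x | forall r, prime r -> (r %|| x) = (r == q)].

Lemma prime_dvdzX (r : nat) (x : int) m : prime r ->
  (r %|| x ^+ m.+1) = (r %|| x).
Proof. by move=> pr; rewrite !dvdzE abszX Euclid_dvdX // andbT. Qed.

Lemma prime_powersX q x m : prime_powers q x -> prime_powers q (x ^+ m.+1).
Proof. by move=> H r pr; rewrite prime_dvdzX // H. Qed.

Lemma prime_powersN q x : prime_powers q x -> prime_powers q (- x).
Proof. by move=> H r pr; rewrite rpredN H. Qed.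

Lemma prime_powers_prime q : prime q -> prime_powers q q%:Z.
Proof. by move=> pq r pr; rewrite dvdzE /= dvdn_prime2. Qed.

Lemma prime_powersE q x : prime q -> prime_powers q x ->
  exists m, x = q%:Z ^+ m.+1 \/ x = - q%:Z ^+ m.+1.
Proof.
move=> pq H.
have x0 : x != 0.
  apply: contraTneq isT => x0.
  have [r rq pr] := prime_above q.
  by have := H r pr; rewrite x0 dvdz0 => /esym /eqP er; rewrite er ltnn in rq.
have qx : q.-nat (absz x).
  apply/pnatP; first by rewrite absz_gt0.
  by move=> r pr rx; rewrite !inE -H.
have := H q pq; rewrite eqxx dvdzE => /= dq.
have [m em] := p_natP qx; case: m em => [|m] em.
  by move: dq; rewrite em dvdn1 => /eqP q1; rewrite q1 in pq.
by exists m; rewrite -PoszX -em; move: (x) => y; lia.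
Qed.

Lemma prime_powers_ndvd p q x : prime p -> q != p -> prime_powers q x ->
  ~~ (p %|| x).
Proof. by move=> pp qp H; rewrite H // eq_sym. Qed.

Lemma prime_powers_neq1 q x : prime q -> prime_powers q x -> x != 1 /\ x != -1.
Proof.
move=> pq H; have := H q pq; rewrite eqxx => qx.
split; apply: contraTneq qx => ->; rewrite dvdzE /= dvdn1.
  by apply: contraTneq pq => ->.
by apply: contraTneq pq => ->.
Qed.

Lemma sub_padic_closure p (A : set int) x : A x -> ~~ (p %|| x) ->
  padic_closure p A x.
Proof. by move=> Ax px; split=> // n; exists x => //; rewrite subrr dvdz0. Qed.

Lemma padic_closureX p A x m : prime p -> (forall y i, A y -> A (y ^+ i.+1)) ->
  padic_closure p A x -> padic_closure p A (x ^+ m.+1).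
Proof.
move=> pp AX [px H]; split; first by rewrite prime_dvdzX.
move=> n; have [a Aa ha] := H n; exists (a ^+ m.+1); first exact: AX.
by rewrite subrXX dvdz_mulr.
Qed.

Lemma padic_closureN p A x : (forall y, A y -> A (- y)) ->
  padic_closure p A x -> padic_closure p A (- x).
Proof.
move=> AN [px H]; split; first by rewrite rpredN.
move=> n; have [a Aa ha] := H n; exists (- a); first exact: AN.
by rewrite -opprD rpredN.
Qed.

(** The closed subgroup generated by [q] and [-1] in the units of [Z_p],
intersected with [Z]. *)
Definition padic_group p q := padic_closure p (prime_powers q).

(** Intersecting the powers of [q] with a subgroup at another prime [p'] keeps
only the powers whose exponent is a multiple of some integer; varying [p'] yields
subgroups that no single prime need generate. *)
Definition padic_group_trace p q p' r :=
  padic_closure p (prime_powers q `&` padic_group p' r).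

Lemma padic_groupX p q x m : prime p -> padic_group p q x ->
  padic_group p q (x ^+ m.+1).
Proof. by move=> pp; apply: padic_closureX => // y i; apply: prime_powersX. Qed.

Lemma padic_groupN p q x : padic_group p q x -> padic_group p q (- x).
Proof. by apply: padic_closureN => y; apply: prime_powersN. Qed.

Lemma mem_padic_group p q x : prime p -> q != p -> prime_powers q x ->
  padic_group p q x.
Proof.
by move=> pp qp hx; apply: sub_padic_closure => //; apply: (@prime_powers_ndvd _ q).
Qed.

Lemma padic_group_near1 p q : prime p -> prime q -> q != p ->
    near1 p (base_level p) q%:Z ->
  exists2 k, (base_level p <= k)%N & padic_group p q = [set x | near1 p k x].
Proof.
move=> pp pq qp hq; have Qq := prime_powers_prime pq.
have [q1 q2] := prime_powers_neq1 pq Qq.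
apply: (@padic_closure_near1 _ _ q%:Z) => //.
- by move=> x m; apply: prime_powersX.
- by move=> x; apply: prime_powersN.
- move=> x /(prime_powersE pq)[m [->|->]]; rewrite ?near1N; exact: near1X.
Qed.

Lemma padic_group_level p q k : prime p -> prime q -> (base_level p <= k)%N ->
    near1 p k q%:Z -> ~~ near1 p k.+1 q%:Z ->
  padic_group p q = [set x | near1 p k x].
Proof.
move=> pp pq hk hq hqN.
apply: (@padic_closure_level _ _ _ q%:Z) => //.
- by move=> x m; apply: prime_powersX.
- by move=> x; apply: prime_powersN.
- by move=> x /(prime_powersE pq)[m [->|->]]; rewrite ?near1N; exact: near1X.
- exact: prime_powers_prime.
Qed.

Lemma eulerz q n : prime q -> coprime q n ->
  n %|| q%:Z ^+ totient n - 1.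
Proof.
move=> pq cqn; have := Euler_exp_totient cqn => /eqP.
by rewrite -eqz_nat -!modz_nat => /eqP h; rewrite -eqz_mod_dvd -PoszX; apply/eqP.
Qed.

Lemma exists_power_near1 p k q : prime p -> prime q -> q != p ->
  exists m, near1 p k (q%:Z ^+ m.+1).
Proof.
move=> pp pq qp; exists (totient (p ^ k)).-1; rewrite prednK; last first.
  by rewrite totient_gt0 expn_gt0 prime_gt0.
apply/orP; left; apply: eulerz => //.
by rewrite coprimeXr // prime_coprime // dvdn_prime2.
Qed.

(** The powers of [q] close to [1] or [-1], up to sign, generate a congruence
subgroup, by [padic_closure_near1]. *)
Lemma padic_group_near1_part p q : prime p -> prime q -> q != p ->
  exists j, [/\ (base_level p <= j)%N,
    [set x | near1 p j x] `<=` padic_group p q &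
    forall x, prime_powers q x -> near1 p (base_level p) x -> near1 p j x].
Proof.
move=> pp pq qp; pose B := prime_powers q `&` [set x | near1 p (base_level p) x].
have [m hm] := exists_power_near1 (base_level p) pp pq qp.
have Qm : prime_powers q (q%:Z ^+ m.+1) by apply/prime_powersX/prime_powers_prime.
have [q1 q2] := prime_powers_neq1 pq Qm.
have [j hj ej] : exists2 k, (base_level p <= k)%N &
    padic_closure p B = [set x | near1 p k x].
  apply: (@padic_closure_near1 _ _ (q%:Z ^+ m.+1)) => //.
  - by move=> x i [h1 h2]; split; [apply: prime_powersX|apply: near1X].
  - by move=> x [h1 h2]; split; [apply: prime_powersN|rewrite /= near1N].
  - by move=> x [].
exists j; split=> //; first by rewrite -ej; apply: padic_closureS => x [].
move=> x Qx hx; suff : padic_closure p B x by rewrite ej.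
by apply: sub_padic_closure => //; apply: (@prime_powers_ndvd _ q).
Qed.

Lemma padic_group_trace_near1 p q p' r :
    prime p -> prime q -> prime p' -> prime r -> q != p -> q != p' -> r != p' ->
    (forall x, padic_group_trace p q p' r x -> near1 p (base_level p) x) ->
  exists2 k, (base_level p <= k)%N & padic_group_trace p q p' r = [set x | near1 p k x].
Proof.
move=> pp pq pp' pr qp qp' rp' H.
have [j [_ hj _]] := padic_group_near1_part pp' pr rp'.
have [m /hj Km] := exists_power_near1 j pp' pq qp'.
have Qm : prime_powers q (q%:Z ^+ m.+1) by apply/prime_powersX/prime_powers_prime.
have [q1 q2] := prime_powers_neq1 pq Qm.
apply: (@padic_closure_near1 _ _ (q%:Z ^+ m.+1)) => //.
- by move=> x i [h1 h2]; split; [apply: prime_powersX|apply: padic_groupX].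
- by move=> x [h1 h2]; split; [apply: prime_powersN|apply: padic_groupN].
- move=> x Ax; apply: H; apply: sub_padic_closure => //.
  by case: Ax => Ax _; apply: (@prime_powers_ndvd _ q).
Qed.

(** Linear order below [padic_group p q], tested on pairs made of a group and a
trace.  Being expressed through prime divisors and [p]-adic closures only, the
property is invariant under homeomorphisms. *)
Definition chainlike p q := forall q1 q2 p' r,
  prime q1 -> prime q2 -> prime p' -> prime r ->
  q1 != p -> q2 != p -> q2 != p' -> r != p' ->
  padic_group p q1 `<=` padic_group p q ->
  padic_group_trace p q2 p' r `<=` padic_group p q ->
  padic_group p q1 `<=` padic_group_trace p q2 p' r \/
  padic_group_trace p q2 p' r `<=` padic_group p q1.

(** All groups and traces inside a congruence subgroup are congruence
subgroups themselves, by [padic_closure_near1]. *)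
Lemma near1_chainlike p q k : prime p -> (base_level p <= k)%N ->
  padic_group p q = [set x | near1 p k x] -> chainlike p q.
Proof.
move=> pp hk e q1 q2 p' r pq1 pq2 pp' pr q1p q2p q2p' rp'; rewrite e => h1 h2.
have [j1 _ ->] : exists2 j, (base_level p <= j)%N &
    padic_group p q1 = [set x | near1 p j x].
  apply: padic_group_near1 => //; apply: near1_le hk _; apply: h1.
  exact/mem_padic_group/prime_powers_prime.
have [j2 _ ->] : exists2 j, (base_level p <= j)%N &
    padic_group_trace p q2 p' r = [set x | near1 p j x].
  apply: padic_group_trace_near1 => // x /h2; exact: near1_le.
have [le|/ltnW le] := leqP j2 j1; [left|right] => x; exact: near1_le.
Qed.

(** For these primes the units of [Z_p] modulo [-1] form a pro-[p] group. *)
Lemma near1_small p x : prime p -> (p <= 3)%N -> ~~ (p %|| x) ->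
  near1 p (base_level p) x.
Proof.
case: p => [|[|[|[|]]]] // _ _; rewrite /near1 /base_level /=.
  by have -> : (2 ^ 2 = 4)%N by []; lia.
by rewrite expn1; lia.
Qed.

Lemma near1_powp p k x : prime p -> (0 < k)%N -> near1 p k x ->
  near1 p k.+1 (x ^+ p).
Proof.
move=> pp k0; wlog hx : x / (p ^ k)%N %|| x - 1.
  move=> H h; case/orP: (h) => hx; first exact: H.
  have : near1 p k.+1 ((- x) ^+ p).
    apply: H; first by rewrite -opprD rpredN.
    by rewrite near1N.
  by rewrite exprNn -signr_odd; case: (odd p); rewrite ?mulN1r ?near1N ?mul1r.
move=> _; apply/orP; left; rewrite subrX1 expnSr PoszM dvdz_mul //.
have hi i : p %|| x ^+ i - 1.
  by rewrite subrX1 dvdz_mulr // -(expn1 p); apply: dvdz_exp_le hx.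
rewrite -[X in _ %|| X](subrK p%:Z) rpredD //.
have -> : \sum_(i < p) x ^+ i - p%:Z = \sum_(i < p) (x ^+ i - 1).
  by rewrite sumrB sumr_const card_ord natz.
by apply: rpred_sum => i _.
Qed.

Lemma fermat_near1 p x : prime p -> near1 p 1 (x ^+ p) -> near1 p 1 x.
Proof.
move=> pp; apply: near1_congr; rewrite expn1.
have [px|px] := boolP (p %|| x); first by rewrite rpredB // dvdz_exp // prime_gt0.
have -> : x - x ^+ p = - x * (x ^+ p.-1 - 1).
  by rewrite mulrBr mulNr -exprS prednK ?prime_gt0 // mulr1 opprK addrC.
by rewrite dvdz_mull // fermatz.
Qed.

(** Any prime divisor of [1 + q + ... + q ^ (p - 1)] will do: it cannot divide
[q - 1], as it would then divide [p]. *)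
Lemma exists_prime_of_order p q : prime p -> prime q -> odd p ->
    ~~ (p %|| q%:Z - 1) ->
  exists P, [/\ prime P, P != q, P != 2, P %|| q%:Z ^+ p - 1
            & ~~ (P %|| q%:Z - 1)].
Proof.
move=> pp pq op q1.
pose N := (\sum_(i < p) q ^ i)%N.
have eN : N%:Z = \sum_(i < p) q%:Z ^+ i.
  by rewrite /N -natz raddf_sum /=; apply: eq_bigr => i _; rewrite natz PoszX.
have p0 := prime_gt0 pp.
have N1 : (1 < N)%N.
  rewrite /N -(prednK p0) big_ord_recl expn0 -[1%N]addn0 ltn_add2l.
  have : (0 < p.-1)%N by have := prime_gt1 pp; lia.
  case: p.-1 => // n _; rewrite big_ord_recl /= addn_gt0.
  by rewrite expn_gt0 prime_gt0.
have pP := pdiv_prime N1; have dP : pdiv N %|| N%:Z := pdiv_dvd N.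
move: (pdiv N) pP dP => P pP dP.
have Pq : P != q.
  apply: contraTneq dP => ->; rewrite eN -(prednK p0) big_ord_recl expr0.
  apply/negP => h; have : q %|| \sum_(i < p.-1) q%:Z ^+ bump 0 i.
    by apply: rpred_sum => i _; rewrite exprS dvdz_mulr.
  by move=> /(rpredB h); rewrite addrK dvdzE /= dvdn1 => /eqP e; rewrite e in pq.
have Pqp : P %|| q%:Z ^+ p - 1 by rewrite subrX1 -eN dvdz_mull.
have Pq1 : ~~ (P %|| q%:Z - 1).
  apply/negP => h; have hi i : P %|| q%:Z ^+ i - 1 by rewrite subrX1 dvdz_mulr.
  have : P %|| N%:Z - p%:Z.
    have -> : N%:Z - p%:Z = \sum_(i < p) (q%:Z ^+ i - 1).
      by rewrite sumrB sumr_const card_ord natz eN.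
    by apply: rpred_sum => i _.
  move=> /(rpredB dP); rewrite subKr dvdzE /= dvdn_prime2 // => /eqP e.
  by rewrite -e h in q1.
exists P; split=> //; apply/eqP => P2; move: Pq1 Pqp; rewrite P2.
have [q2|oq] := even_prime pq.
  by rewrite P2 q2 in Pq.
by rewrite dvdzE /= => h; have := prime_gt1 pq; lia.
Qed.

(** If [q] is not [1] or [-1] modulo [p], then [3 < p], and two incomparable
subgroups are found below [padic_group p q].  One is the congruence subgroup of the
level [j] at which it meets the neighbourhood of [1] and [-1].  The other is the
trace generated by [q ^ p], obtained from a prime [P] modulo which [q] has order
[p]: it is not close to [1] or [-1] since [q ^ p = q] modulo [p], and its elements
that are close have level at least [j + 1], being [p]-th powers of close ones. *)
Lemma chainlike_near1 p q : prime p -> prime q -> q != p -> chainlike p q ->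
  exists2 k, (base_level p <= k)%N & padic_group p q = [set x | near1 p k x].
Proof.
move=> pp pq qp chain.
have [hq|hq] := boolP (near1 p (base_level p) q%:Z).
  exact: padic_group_near1.
exfalso.
have p3 : (3 < p)%N.
  rewrite ltnNge; apply: contra hq => p3; apply: near1_small => //.
  by rewrite dvdzE /= dvdn_prime2 // eq_sym.
have p2 : (p == 2)%N = false by apply/eqP; lia.
have bp : base_level p = 1%N by rewrite /base_level p2.
have op : odd p by case: (even_prime pp) p2 => // ->.
have [j [hj jK Bj]] := padic_group_near1_part pp pq qp.
have [r1 [pr1 r1j r1jN]] := exists_prime_level pp hj.
have r1p : r1 != p.
  apply: contraTneq (near1_ndvd pp (leq_trans (base_level_gt0 p) hj) r1j) => ->.
  by rewrite negbK.
have eK1 := padic_group_level pp pr1 hj r1j r1jN.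
rewrite bp in hq hj Bj.
have hq1 : ~~ (p %|| q%:Z - 1) by apply: contra hq; rewrite /near1 expn1 => ->.
have [P [pP Pq P2 Pqp Pq1]] := exists_prime_of_order pp pq op hq1.
have bP : base_level P = 1%N by rewrite /base_level (negPf P2).
have hP : (base_level P <= 1)%N by rewrite bP.
have [r2 [pr2 r2j r2jN]] := exists_prime_level pP hP.
have r2P : r2 != P.
  by apply: contraTneq (near1_ndvd pP _ r2j) => // ->; rewrite negbK.
have eKP := padic_group_level pP pr2 hP r2j r2jN.
have qP : q != P by rewrite eq_sym.
have h1 : padic_group p r1 `<=` padic_group p q by rewrite eK1.
have h2 : padic_group_trace p q P r2 `<=` padic_group p q.
  by apply: padic_closureS => x [].
have j0 : (0 < j)%N by [].
case: (chain r1 q P r2 pr1 pq pP pr2 r1p qp qP r2P h1 h2); rewrite eK1 => h.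
  have /h[_ /(_ j.+1)[a [Qa]]] : near1 p j (1 + (p ^ j)%N%:Z).
    by rewrite /near1 addrC addKr dvdzz.
  rewrite /= eKP /= => aP ha.
  have [m em] := prime_powersE pq Qa.
  have /dvdnP[t et] : (p %| m.+1)%N.
    have hPa : P %|| q%:Z ^+ (m.+1 * 2) - 1.
      have : near1 P 1 (q%:Z ^+ m.+1) by case: em aP => ->; rewrite ?near1N.
      rewrite exprM -[X in _ - X](expr1n _ 2) subr_sqr /near1 expn1.
      by case/orP => ?; [rewrite dvdz_mulr|rewrite dvdz_mull].
    have := dvdz_exp_gcd hPa Pqp.
    have /primeP[_ /(_ _ (dvdn_gcdr (m.+1 * 2) p))] := pp.
    move=> /orP[|] /eqP eg; first by rewrite eg expr1 (negPf Pq1).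
    move=> _; have := dvdn_gcdl (m.+1 * 2) p; rewrite eg Euclid_dvdM //.
    by case/orP=> //; rewrite dvdn_prime2 // p2.
  have {hP} t0 : (0 < t)%N by case: t et.
  have a1 : near1 p 1 a.
    apply: (@near1_congr _ _ (1 + (p ^ j)%N%:Z)).
      by apply: dvdz_exp_le ha.
    by rewrite /near1 addrC addKr dvdzE /= expn1 dvdn_exp.
  have : near1 p j.+1 (q%:Z ^+ (t * p)).
    rewrite exprM; apply: near1_powp => //; apply: Bj.
      by rewrite -(prednK t0); apply/prime_powersX/prime_powers_prime.
    apply: fermat_near1 => //; rewrite -exprM -et.
    by case: em a1 => ->; rewrite ?near1N.
  rewrite -et => hm.
  have : near1 p j.+1 (1 + (p ^ j)%N%:Z).
    apply: near1_congr (_ : near1 p j.+1 a); first by rewrite -opprB rpredN.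
    by case: em => ->; rewrite ?near1N.
  case/orP.
    rewrite addrC addKr dvdzE /= dvdn_Pexp2l ?ltnn //; exact: prime_gt1.
  move=> /(dvdz_exp_le (ltnW (ltnSn j))).
  have -> : 1 + (p ^ j)%N%:Z + 1 = (p ^ j)%N%:Z + 2 by ring.
  rewrite rpredDl; last exact: dvdzz.
  by apply/negP; apply: base_level_ndvd2 => //; rewrite bp.
have Qp : padic_group_trace p q P r2 (q%:Z ^+ p).
  have eqp : q%:Z ^+ p = q%:Z ^+ p.-1.+1 by rewrite prednK // prime_gt0.
  apply: sub_padic_closure; last first.
    by rewrite eqp prime_dvdzX // dvdzE /= dvdn_prime2 // eq_sym.
  split; last by rewrite eKP /= /near1 expn1 Pqp.
  by rewrite eqp; apply/prime_powersX/prime_powers_prime.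
by case/negP: hq; apply: fermat_near1 => //; apply: near1_le (h _ Qp).
Qed.

Lemma exists_padic_group_near1 p k : prime p -> (base_level p <= k)%N ->
  exists q, [/\ prime q, q != p & padic_group p q = [set x | near1 p k x]].
Proof.
move=> pp hk; have [q [pq h1 h2]] := exists_prime_level pp hk.
exists q; split=> //; last exact: padic_group_level.
apply: contraTneq (near1_ndvd pp (leq_trans (base_level_gt0 p) hk) h1) => ->.
by rewrite negbK.
Qed.

(** * Neighbourhoods and closures in the Golomb space *)

Definition progression (x : GZ) (n : nat) : set GZ := [set z | n %|| val z - val x].

Lemma open_progression (x : GZ) (n : nat) : (0 < n)%N -> coprimez (val x) n ->
  open (progression x n).
Proof.
move=> n0 cop; exists [set progression x n]; last by rewrite bigcup_set1.
move=> _ ->; apply: finI_from1 => /=.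
exists (val x), [set y | n %|| y]; split.
- split=> [|y z|r y] /=; first exact: dvdz0.
    exact: rpredD.
  exact: dvdz_mull.
- move=> e; have : [set y | n %|| y] n%:Z by exact: dvdzz.
  by rewrite e /=; lia.
- rewrite predeqE => y; split=> // _ I [[I0 ID IM] sub].
  have [[u v] /= e] := coprimezP _ _ cop.
  rewrite -[y]mulr1 -e mulrDr !mulrA; apply: ID; apply: IM; apply: sub.
    by left.
  by right; exact: dvdzz.
- rewrite predeqE => z; split=> /= [h|[y hy <-]].
    by exists (val z - val x) => //; rewrite subrKC.
  by rewrite addrAC subrr add0r.
Qed.

Definition contains_progression (x : GZ) : set_system GZ := [set U |
  exists n, [/\ (0 < n)%N, coprimez (val x) n & progression x n `<=` U]].

Lemma contains_progression_filter x : Filter (contains_progression x).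
Proof.
split.
- by exists 1%N; split=> //; rewrite coprimezE coprimen1.
- move=> P Q [m [m0 cm sm]] [n [n0 cn sn]]; exists (m * n)%N; split.
  + by rewrite muln_gt0 m0.
  + by rewrite PoszM coprimezMr cm.
  + move=> z hz; split; [apply: sm|apply: sn]; apply: dvdz_trans hz.
      by rewrite dvdzE /= dvdn_mulr.
    by rewrite dvdzE /= dvdn_mull.
- move=> P Q PQ [n [n0 cn sn]]; exists n; split=> //.
  exact: subset_trans PQ.
Qed.

(** From [a + I] containing [x] with [a] and [I] comaximal one gets
[r * x + i = 1] for some [i] in [I]; then [i] is prime to [x], and [x + iZ] is
contained in [a + I]. *)
Lemma golomb_subbase_progression (x : GZ) U : golomb_subbase U -> U x ->
  contains_progression x U.
Proof.
move=> [a [I [[I0 ID IM] In gen ->]]] /= [y Iy ey'].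
have ey : val x = a + y := esym ey'.
have [i0 Ii0 i0n] : exists2 i, I i & i != 0.
  apply: contrapT => H; apply: In; rewrite predeqE => i; split=> [Ii|->//].
  by apply: contrapT => /eqP i0; apply: H; exists i.
have : ideal_gen (a |` I) 1 by rewrite gen.
have idJ : is_ideal [set r * val x + i | r in setT & i in I].
  split.
  - by exists 0 => //; exists 0 => //; rewrite mul0r addr0.
  - move=> _ _ [r _ [i Ii <-]] [s _ [j Ij <-]].
    exists (r + s) => //; exists (i + j); first exact: ID.
    by rewrite mulrDl addrACA.
  - move=> r _ [s _ [i Ii <-]]; exists (r * s) => //.
    by exists (r * i); [exact: IM|rewrite mulrDr mulrA].
move=> /(_ _ (conj idJ _)) [].
  move=> z [->|Iz]; last by exists 0 => //; exists z; rewrite ?mul0r ?add0r.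
  exists 1 => //; exists (- 1 * y); first exact: IM.
  by rewrite mul1r mulN1r ey addrK.
move=> r _ [i Ii e].
have sub (j : int) : I j -> progression x (absz j) `<=`
    [set z : GZ | coset a I (val z)].
  move=> Ij z /dvdzP[c hc] /=; exists (y + val z - val x).
    rewrite -addrA hc; apply: ID => //.
    have -> : c * Posz (absz j) = (c * Num.sg j) * j by rewrite -mulrA; congr (_ * _); lia.
    exact: IM.
  by rewrite ey; ring.
have [i0'|i0'] := eqVneq i 0.
  exists (absz i0); split; [by rewrite absz_gt0| |exact: sub].
  have : (val x %| (1 : int)%R)%Z by rewrite -e i0' addr0 dvdz_mull.
  by rewrite dvdz1 coprimezE => /eqP ->; rewrite coprime1n.
exists (absz i). split; [by rewrite absz_gt0| |exact: sub].
have : coprimez (val x) i by apply/coprimezP; exists (r, 1); rewrite mul1r.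
by rewrite !coprimezE.
Qed.

Lemma nbhs_golombP (x : GZ) U : nbhs x U <-> contains_progression x U.
Proof.
split.
  move=> [V [[D' sD <-] [W DW Wx] sVU]].
  have FF := contains_progression_filter x.
  apply: filterS sVU _; apply: (@filterS _ _ _ W); first by move=> y Wy; exists W.
  have [E sE eW] := sD _ DW; rewrite -eW; apply: filter_bigI => i iE.
  apply: golomb_subbase_progression; first by have := sE i iE; rewrite inE.
  by move: Wx; rewrite -eW => /(_ i iE).
move=> [n [n0 cn sn]]; exists (progression x n); split=> //.
  exact: open_progression.
by rewrite /progression /= subrr dvdz0.
Qed.

(** Chinese remainders for arbitrary moduli; adding [m * n] if needed makes the
solution nonzero. *)
Lemma exists_congruent (m n : nat) (a b : int) : (0 < m)%N -> (0 < n)%N ->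
  gcdn m n %|| a - b -> exists w : GZ, m %|| val w - a /\ n %|| val w - b.
Proof.
move=> m0 n0 /dvdzP[c ec]; have [u [v e]] := Bezoutz m n.
rewrite -[Posz (gcdn m n)]/(gcdz m n) -e in ec.
have sol (w : int) : w = a - m%:Z * u * c \/ w = a - m%:Z * u * c + m%:Z * n%:Z ->
    m %|| w - a /\ n %|| w - b.
  move=> [->|->]; split; apply/dvdzP.
  - by exists (- (u * c)); ring.
  - exists (c * v); have -> : a = b + c * (u * m + v * n) by rewrite -ec subrKC.
    by ring.
  - by exists (- (u * c) + n%:Z); ring.
  - exists (c * v + m%:Z); have -> : a = b + c * (u * m + v * n) by rewrite -ec subrKC.
    by ring.
have [w0|w0] := eqVneq (a - m%:Z * u * c) 0; last first.
  by exists (exist (fun w : int => w != 0) _ w0); apply: sol; left.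
have w1 : a - m%:Z * u * c + m%:Z * n%:Z != 0.
  by rewrite w0 add0r mulf_neq0 // -lt0n.
by exists (exist (fun w : int => w != 0) _ w1); apply: sol; right.
Qed.

Lemma dvdz_prime_powers n (x : int) : (0 < n)%N ->
  (forall p k, prime p -> (p ^ k %| n)%N -> (p ^ k)%N %|| x) -> n %|| x.
Proof.
move=> n0 H; rewrite dvdzE /=.
have [->|x0] := eqVneq x 0; first by rewrite dvdn0.
apply/dvdn_partP => // p; rewrite mem_primes => /andP[pp _].
by rewrite p_part; apply: H => //; rewrite pfactor_dvdnn.
Qed.

Lemma coprimez_ndvd (p n : nat) (x : int) : prime p -> coprimez x n -> p %|| x ->
  ~~ (p %| n)%N.
Proof.
move=> pp cop px; apply/negP => pn.
have : (p %| gcdn (absz x) n)%N by rewrite dvdn_gcd pn [(p %| _)%N]px.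
move: cop; rewrite coprimezE => /eqP /= ->; rewrite dvdn1 => /eqP p1.
by rewrite p1 in pp.
Qed.

(** A progression [z + mZ] with [m] prime to [z] meets [x + nZ] iff the greatest
common divisor of [m] and [n] divides [z - x]; here only the primes not dividing
[z] matter. *)
Lemma closure_progressionP (x z : GZ) n : (0 < n)%N ->
  closure (progression x n) z <->
  forall p k, prime p -> (p ^ k %| n)%N ->
    (p %|| val z) || ((p ^ k)%N %|| val z - val x).
Proof.
move=> n0; split=> [cl p k pp pkn|H U /nbhs_golombP[m [m0 cm sm]]].
  have [//|pz /=] := boolP (p %|| val z).
  have [|w [/= wx wz]] := cl (progression z (p ^ k)).
    apply/nbhs_golombP; exists (p ^ k)%N; split=> //.
      by rewrite expn_gt0 prime_gt0.
    by rewrite coprimezE coprimeXr // coprime_sym prime_coprime.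
  have -> : val z - val x = (val w - val x) - (val w - val z) by ring.
  by rewrite rpredB //; apply: dvdz_trans wx.
have [|w [w1 w2]] := @exists_congruent n m (val x) (val z) n0 m0.
  apply: dvdz_prime_powers; first by rewrite gcdn_gt0 n0.
  move=> p [|k] pp; first by rewrite expn0 dvd1z.
  rewrite dvdn_gcd => /andP[pn pm].
  case/orP: (H p k.+1 pp pn) => [pz|]; last by rewrite -opprB rpredN.
  case/negP: (coprimez_ndvd pp cm pz).
  by rewrite (dvdn_trans _ pm) // expnS dvdn_mulr.
by exists w; split=> //; apply: sm.
Qed.

Lemma nbhs_progression (x : GZ) n : (0 < n)%N -> coprimez (val x) n ->
  nbhs x (progression x n).
Proof. by move=> n0 cn; apply/nbhs_golombP; exists n; split. Qed.

(** * Homeomorphisms and prime divisors *)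

(** The filter generated by the intersections of closures of neighbourhoods of
[x] and [y] is contained in the one of [x'] and [y']. *)
Definition refines (T : topologicalType) (x y x' y' : T) := forall U V,
  nbhs x U -> nbhs y V -> exists U' V', [/\ nbhs x' U', nbhs y' V' &
    closure U' `&` closure V' `<=` closure U `&` closure V].

Lemma refinesC (T : topologicalType) (x y x' y' : T) :
  refines x y x' y' -> refines y x y' x'.
Proof.
move=> R U V hU hV; have [V' [U' [hV' hU' s]]] := R V U hV hU.
by exists U', V'; split=> //; rewrite setIC [X in _ `<=` X]setIC.
Qed.

Lemma closure_preimage (S T : topologicalType) (f : S -> T) (B : set T) :
  continuous f -> closure (f @^-1` B) `<=` f @^-1` closure B.
Proof.
move=> cf x cl U hU; have [y [By Uy]] := cl _ (cf x U hU).
by exists (f y).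
Qed.

Lemma refines_homeo (T : topologicalType) (f g : T -> T) (x y x' y' : T) :
    continuous f -> continuous g -> cancel f g -> cancel g f ->
  refines x y x' y' -> refines (f x) (f y) (f x') (f y').
Proof.
move=> cf cg fK gK R U V hU hV.
have [U' [V' [hU' hV' s]]] := R _ _ (cf x U hU) (cf y V hV).
have hg w W : nbhs w W -> nbhs (f w) (g @^-1` W).
  by move=> hW; apply: cg; rewrite fK.
exists (g @^-1` U'), (g @^-1` V'); split; [exact: hg|exact: hg|].
move=> z [/(closure_preimage cg) zU /(closure_preimage cg) zV].
have [/(closure_preimage cf) h1 /(closure_preimage cf) h2] := s _ (conj zU zV).
by move: h1 h2; rewrite /= gK.
Qed.

Lemma absz1_ndvd p (x : int) : prime p -> absz x = 1%N -> ~~ (p %|| x).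
Proof.
by move=> pp x1; rewrite dvdzE x1 /= dvdn1; apply: contraTneq pp => ->.
Qed.

Lemma unit_coprimez (x : int) n : absz x = 1%N -> coprimez x n.
Proof. by move=> x1; rewrite coprimezE x1 coprime1n. Qed.

Lemma ndvdz_large_power p (x y : int) : prime p -> x != y ->
  ~~ ((p ^ (absz (x - y)).+1)%N %|| x - y).
Proof.
move=> pp xy; apply/negP; rewrite dvdzE /= => /dvdn_leq.
rewrite absz_gt0 subr_eq0 xy => /(_ isT).
by have := ltn_expl (absz (x - y)).+1 (prime_gt1 pp); lia.
Qed.

(** A prime dividing neither [x'] nor [y'] divides every point in both closures
as soon as the moduli contain a power of it that does not divide [x' - y'].  As
[x'] is a unit, the remaining primes divide [y'], hence [y], and at those the
conditions imposed near [x = x'] are the same on both sides. *)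
Lemma refines_sufficient (x y x' y' : GZ) : x' != y' -> absz (val x') = 1%N ->
    (forall p, prime p -> p %|| val y' -> p %|| val y /\ x = x') ->
  refines x y x' y'.
Proof.
move=> neq x1 H U V /nbhs_golombP[n [n0 cn sn]] /nbhs_golombP[m [m0 cm sm]].
have neqv : val x' != val y' by [].
pose K := (absz (val x' - val y')).+1.
pose N := ((n * m) ^ K)%N.
have N0 : (0 < N)%N by rewrite expn_gt0 muln_gt0 n0 m0.
pose pi := [pred p | ~~ (p %|| val y')].
have M0 : (0 < N`_pi)%N by rewrite part_gt0.
exists (progression x' N), (progression y' N`_pi); split.
- by apply: nbhs_progression => //; apply: unit_coprimez.
- apply: nbhs_progression => //; rewrite coprimezE coprime_sym.
  apply: (@pnat_coprime pi); first exact: part_pnat.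
  apply/pnatP; first by rewrite absz_gt0; exact: (valP y').
  by move=> p pp py; rewrite !inE negbK.
move=> z [/closure_progressionP hx /closure_progressionP hy].
have key p : prime p -> (p %| n * m)%N -> ~~ (p %|| val y') -> p %|| val z.
  move=> pp pnm py.
  have pN : (p ^ K %| N)%N by apply: dvdn_exp2r.
  have pM : (p ^ K %| N`_pi)%N.
    rewrite -(@part_pnat_id pi (p ^ K)); first exact: partn_dvd.
    by rewrite pnatX pnatE //= !inE py.
  apply: contraT => pz.
  have := hx N0 p K pp pN; rewrite (negPf pz) /= => h1.
  have := hy M0 p K pp pM; rewrite (negPf pz) /= => h2.
  case/negP: (ndvdz_large_power pp neqv).
  have e : (val z - val y') - (val z - val x') = val x' - val y' by ring.
  by have := rpredB h2 h1; rewrite e.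
split.
  apply: closure_subset sn _ _; apply/closure_progressionP => // p [|k] pp pkn.
    by rewrite expn0 dvd1z orbT.
  have pn : (p %| n)%N by rewrite (dvdn_trans _ pkn) // expnS dvdn_mulr.
  have [py|py] := boolP (p %|| val y').
    have [_ ->] := H p pp py; apply: hx => //.
    rewrite (dvdn_trans pkn) // /N (dvdn_trans (dvdn_mulr m (dvdnn n))) //.
    by rewrite dvdn_exp.
  by rewrite key // dvdn_mulr.
apply: closure_subset sm _ _; apply/closure_progressionP => // p [|k] pp pkm.
  by rewrite expn0 dvd1z orbT.
have pm : (p %| m)%N by rewrite (dvdn_trans _ pkm) // expnS dvdn_mulr.
rewrite key // ?dvdn_mull //; apply/negP => /(H p pp)[py _].
by have := coprimez_ndvd pp cm py; rewrite pm.
Qed.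

(** A point which imitates [c] at [p] and is divisible by the other primes in
play; such points lie in closures of progressions as soon as these are compatible
at [p] ([closure_concentrated]). *)
Lemma exists_concentrated p e (c : int) N : prime p -> (0 < N)%N ->
  exists w : GZ, (p ^ e)%N %|| val w - c /\
    forall q, prime q -> q != p -> (q %| N)%N -> q %|| val w.
Proof.
move=> pp N0.
have pN' : ~~ (p %| N`_p^')%N by rewrite -p'natE // part_pnat.
have [|||w [w1 w2]] := @exists_congruent (p ^ e)%N (N`_p^')%N c 0.
- by rewrite expn_gt0 prime_gt0.
- by rewrite part_gt0.
- rewrite (_ : gcdn _ _ = 1%N) ?dvd1z //; apply/eqP.
  by rewrite -/(coprime _ _) coprimeXl // prime_coprime.
rewrite subr0 in w2; exists w; split=> // q pq qp qN.
apply: dvdz_trans w2; rewrite dvdzE /=.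
have : (q %| N`_p * N`_p^')%N by rewrite partnC.
rewrite Euclid_dvdM // => /orP[|//]; rewrite p_part Euclid_dvdX //.
by rewrite dvdn_prime2 // (negPf qp).
Qed.

Lemma closure_concentrated p (x w : GZ) n : prime p -> (0 < n)%N ->
    (forall q, prime q -> q != p -> (q %| n)%N -> q %|| val w) ->
    ((p %| n)%N -> (p ^ n)%N %|| val w - val x) ->
  closure (progression x n) w.
Proof.
move=> pp n0 Hq Hp; apply/closure_progressionP => // q [|k] pq qkn.
  by rewrite expn0 dvd1z orbT.
have qn : (q %| n)%N by rewrite (dvdn_trans _ qkn) // expnS dvdn_mulr.
have [eqp|qp] := eqVneq q p; last by rewrite Hq.
rewrite {}eqp in qn qkn *; apply/orP; right; apply: dvdz_exp_le (Hp qn).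
exact: leq_trans (ltnW (ltn_expl _ (prime_gt1 pp))) (dvdn_leq n0 qkn).
Qed.

(** Separate [x] from [y] at [p]: the closures then meet inside [pZ].  If [p]
divided [y'], neighbourhoods of [y'] would impose no condition at [p], and a point
prime to [p] would remain in the intersection of the closures near [x'] and
[y']. *)
Lemma refines_necessary p (x y x' y' : GZ) : prime p -> x != y ->
  refines x y x' y' -> ~~ (p %|| val x) -> ~~ (p %|| val y) ->
  ~~ (p %|| val y').
Proof.
move=> pp neq R px py; apply/negP => py'.
have neqv : val x != val y by [].
pose K := (absz (val x - val y)).+1.
have pK0 : (0 < p ^ K)%N by rewrite expn_gt0 prime_gt0.
have nb (w : GZ) : ~~ (p %|| val w) -> nbhs w (progression w (p ^ K)).
  move=> pw; apply: nbhs_progression => //.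
  by rewrite coprimezE coprimeXr // coprime_sym prime_coprime.
have [U' [V' [/nbhs_golombP[n [n0 cn sn]] /nbhs_golombP[m [m0 cm sm]] s]]] :=
  R _ _ (nb x px) (nb y py).
have pm := coprimez_ndvd pp cm py'.
pose c : int := if p %|| val x' then 1 else val x'.
have pc : ~~ (p %|| c).
  by rewrite /c; case: ifP => [_|->//]; apply: absz1_ndvd.
have [|w [w1 other]] := @exists_concentrated p n c (n * m) pp.
  by rewrite muln_gt0 n0.
have pw : ~~ (p %|| val w).
  apply: contra pc => pw.
  have : p %|| val w - c by apply: dvdz_trans w1; rewrite dvdzE /= dvdn_exp.
  by move=> /(rpredB pw); rewrite subKr.
case/negP: pw.
have [] : closure (progression x (p ^ K)) w /\ closure (progression y (p ^ K)) w.
  apply: s; split.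
    apply: closure_subset sn _ _; apply: (closure_concentrated pp n0).
      by move=> q pq qp qn; apply: other => //; rewrite dvdn_mulr.
    move=> pn; have px' : ~~ (p %|| val x').
      by apply/negP => /(coprimez_ndvd pp cn); rewrite pn.
    by move: w1; rewrite /c (negPf px').
  apply: closure_subset sm _ _; apply: (closure_concentrated pp m0).
    by move=> q pq qp qm; apply: other => //; rewrite dvdn_mull.
  by rewrite (negPf pm).
move=> /closure_progressionP-/(_ pK0 p K pp (dvdnn _))/orP[//|h1].
move=> /closure_progressionP-/(_ pK0 p K pp (dvdnn _))/orP[//|h2].
case/negP: (ndvdz_large_power pp neqv).
have e : (val w - val y) - (val w - val x) = val x - val y by ring.
by have := rpredB h2 h1; rewrite e.
Qed.

Lemma exists_val (x : int) : x != 0 -> exists z : GZ, val z = x.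
Proof. by move=> x0; exists (exist (fun w : int => w != 0) x x0). Qed.

Record homeo_pair (T : topologicalType) (f g : T -> T) : Prop := HomeoPair {
  hp_cont : continuous f; hp_contV : continuous g;
  hp_can : cancel f g; hp_canV : cancel g f }.

Lemma homeo_pairC (T : topologicalType) (f g : T -> T) :
  homeo_pair f g -> homeo_pair g f.
Proof. by case=> *; split. Qed.

Lemma absz1P (x : int) : x != 0 -> (forall p, prime p -> ~~ (p %|| x)) ->
  absz x = 1%N.
Proof.
move=> x0 H; apply/eqP; apply: contraT => x1.
have pp : prime (pdiv (absz x)) by rewrite pdiv_prime //; lia.
by case/negP: (H _ pp); rewrite dvdzE /= pdiv_dvd.
Qed.

(** The filter attached to a unit and its opposite contains the one of every
other pair, and only pairs of units have this property. *)
Lemma homeo_unit (f g : GZ -> GZ) (x : GZ) : homeo_pair f g ->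
  absz (val x) = 1%N -> absz (val (f x)) = 1%N.
Proof.
move=> [cf cg fK gK] x1.
have [y ey] : exists y : GZ, val y = - val x.
  by apply: exists_val; rewrite oppr_eq0; exact: (valP x).
have y1 : absz (val y) = 1%N by rewrite ey abszN.
have xy : x != y.
  by apply/eqP => exy; have := ey; rewrite -exy; move: x1; case: (val x) => n; lia.
have : refines (g x) (g y) x y.
  by apply: refines_sufficient => // p pp; rewrite (negPf (absz1_ndvd pp y1)).
move=> /(refines_homeo cf cg fK gK); rewrite !gK => /refinesC R.
apply: absz1P; first exact: (valP (f x)).
move=> p pp; by apply: refines_necessary pp _ R (absz1_ndvd pp y1) (absz1_ndvd pp x1);
   rewrite eq_sym.
Qed.

(** Compare the pairs formed by [1] and [x], respectively [1] and [y]. *)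
Lemma homeo_support (f g : GZ -> GZ) (x y : GZ) : homeo_pair f g ->
    (forall p, prime p -> p %|| val y -> p %|| val x) ->
  forall p, prime p -> p %|| val (f y) -> p %|| val (f x).
Proof.
move=> fg H p pp; apply: contraTT => pfx.
have [y1|y1] := eqVneq (absz (val y)) 1%N.
  by apply: absz1_ndvd => //; apply: (homeo_unit fg).
have [u eu] : exists u : GZ, val u = 1 by apply: exists_val.
have u1 : absz (val u) = 1%N by rewrite eu.
have uy : u != y by apply: contraNneq y1 => <-; rewrite u1.
have ux : u != x.
  apply: contraNneq y1 => exu; apply/eqP/absz1P; first exact: (valP y).
  move=> q pq; apply/negP => /(H q pq); rewrite -exu.
  by apply/negP; apply: absz1_ndvd.
have R : refines u x u y by apply: refines_sufficient => // q pq /(H q pq).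
case: (fg) => cf cg fK gK.
apply: (refines_necessary pp _ (refines_homeo cf cg fK gK R)) => //.
  by rewrite (can_eq fK).
by apply: absz1_ndvd => //; apply: (homeo_unit fg).
Qed.

Definition prime_match (f : GZ -> GZ) p q :=
  forall x, (p %|| val x) = (q %|| val (f x)).

(** The image of [p] is not a unit, so some prime [q] divides it; the point
mapped to [q] has its prime divisors among those of [p], hence exactly [p]. *)
Lemma exists_prime_match (f g : GZ -> GZ) p : homeo_pair f g -> prime p ->
  exists2 q, prime q & prime_match f p q.
Proof.
move=> fg pp; have gf := homeo_pairC fg; case: (fg) => cf cg fK gK.
have [P eP] : exists P : GZ, val P = p%:Z.
  by apply: exists_val; have := prime_gt0 pp; lia.
have P1 : absz (val (f P)) != 1%N.
  apply/eqP => /(homeo_unit gf); rewrite fK eP /= => p1.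
  by rewrite p1 in pp.
have [q pq qP] : exists2 q, prime q & q %|| val (f P).
  exists (pdiv (absz (val (f P)))); last by rewrite dvdzE /= pdiv_dvd.
  by rewrite pdiv_prime // ltn_neqAle eq_sym P1 absz_gt0; exact: (valP (f P)).
exists q => //.
have [Q eQ] : exists Q : GZ, val Q = q%:Z.
  by apply: exists_val; have := prime_gt0 pq; lia.
have dvd_prime r s : prime r -> prime s -> r %|| s%:Z -> r = s.
  by move=> pr ps; rewrite dvdzE /= dvdn_prime2 // => /eqP.
(* the support of [g Q] is nonempty and contained in that of [P] *)
have sQ r : prime r -> r %|| val (g Q) -> r = p.
  move=> pr; have := @homeo_support _ _ (f P) Q gf _ r pr; rewrite fK eP.
  move=> h /h hr; apply: (dvd_prime r p) => //; apply: hr => s ps.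
  by rewrite eQ => /(dvd_prime _ _ ps pq) ->.
have pQ : p %|| val (g Q).
  apply: contraT => pQ; have g1 : absz (val (g Q)) = 1%N.
    apply: absz1P; first exact: (valP (g Q)).
    by move=> r pr; apply/negP => h; move: pQ; rewrite -(sQ r pr h) h.
  move: (homeo_unit fg g1); rewrite gK eQ /= => q1.
  by rewrite q1 in pq.
move=> x; apply/idP/idP => [px|qx].
  have := @homeo_support _ _ x (g Q) fg _ q pq; rewrite gK eQ; apply.
    by move=> r pr /(sQ r pr) ->.
  exact: dvdzz.
have := @homeo_support _ _ (f x) Q gf _ p pp; rewrite fK; apply => //.
by move=> r pr; rewrite eQ => /(dvd_prime _ _ pr pq) ->.
Qed.

Lemma prime_match_sym (f g : GZ -> GZ) p q : homeo_pair f g ->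
  prime_match f p q -> prime_match g q p.
Proof. by move=> [_ _ _ gK] H x; rewrite H gK. Qed.

Lemma prime_match_inj (f g : GZ -> GZ) p q q' : homeo_pair f g -> prime q ->
  prime q' -> prime_match f p q -> prime_match f p q' -> q = q'.
Proof.
move=> [_ _ _ gK] pq pq' H H'.
have [Q eQ] : exists Q : GZ, val Q = q%:Z.
  by apply: exists_val; have := prime_gt0 pq; lia.
have := H' (g Q); rewrite H gK eQ dvdzz => /esym.
by rewrite dvdzE /= dvdn_prime2 // => /eqP ->.
Qed.

(** * The topologies at the primes *)

(** Closure of [A] in [O] for the topology generated by the relatively clopen
subsets of an open set [O], a notion that depends only on the topology. *)
Definition relative_quasiclosure (T : topologicalType) (O A : set T) : set T :=
  [set x | O x /\ forall C, open C -> open (O `\` C) -> C `<=` O -> C x ->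
                    A `&` C !=set0].

Lemma quasiclosure_homeo (T : topologicalType) (f g : T -> T) (O A : set T) :
  homeo_pair f g -> relative_quasiclosure (f @^-1` O) (f @^-1` A) `<=`
    f @^-1` relative_quasiclosure O A.
Proof.
move=> [cf cg fK gK] x [Ox H]; split=> // C oC oOC sC Cx.
have /continuousP cfP := cf.
have [//|||//|a [Aa Ca]] := H (f @^-1` C).
- exact: cfP.
- by have := cfP _ oOC.
- by move=> y /sC.
- by exists (f a).
Qed.

Lemma open_golombP (U : set GZ) : open U <->
  forall x, U x -> exists n, [/\ (0 < n)%N, coprimez (val x) n &
                                progression x n `<=` U].
Proof.
split=> [oU x Ux|H]; first by apply/nbhs_golombP; apply: open_nbhs_nbhs.
by rewrite openE => x /H /nbhs_golombP.
Qed.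

Definition nonmultiples p : set GZ := [set x | ~~ (p %|| val x)].

(** Let [x + nZ] be in [C].  If some [y], equal to [x] modulo [p ^ n] and prime to
[p], were outside [C], a progression [y + mZ] would be too, and a point close to
[y] at [p] and divisible by the other primes of [n] and [m] would belong to both
closures.  Here [p ^ n] serves as a power of [p] at least as large as the one
dividing [n]. *)
Lemma relclopen_padic p (C : set GZ) (x : GZ) : prime p ->
    open C -> open (nonmultiples p `\` C) -> C `<=` nonmultiples p -> C x ->
  exists n, progression x (p ^ n) `<=` C.
Proof.
move=> pp /open_golombP oC /open_golombP oC' sC Cx.
have [n [n0 cn sn]] := oC x Cx.
exists n => y /= yx; apply: contrapT => nCy.
have py : nonmultiples p y.
  rewrite /nonmultiples /=; apply: contra (sC _ Cx) => py.
  have : p %|| val y - val x.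
    by apply: dvdz_trans yx; rewrite dvdzE /= dvdn_exp.
  by move=> /(rpredB py); rewrite subKr.
have [m [m0 cm sm]] := oC' y (conj py nCy).
have [|w [w1 w2]] := @exists_concentrated p (n + m) (val y) (n * m) pp.
  by rewrite muln_gt0 n0.
have pw : nonmultiples p w.
  rewrite /nonmultiples /=; apply: contra py => pw.
  have : p %|| val w - val y.
    by apply: dvdz_trans w1; rewrite dvdzE /= dvdn_exp // addn_gt0 n0.
  by move=> /(rpredB pw); rewrite subKr.
have wx : closure C w.
  apply: closure_subset sn _ _; apply: (closure_concentrated pp n0).
    by move=> q pq qp qn; apply: w2 => //; rewrite dvdn_mulr.
  move=> _; rewrite -(subrK (val y) (val w)) -addrA rpredD //.
  by apply: dvdz_exp_le w1; rewrite leq_addr.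
have wy : closure (nonmultiples p `\` C) w.
  apply: closure_subset sm _ _; apply: (closure_concentrated pp m0).
    by move=> q pq qp qn; apply: w2 => //; rewrite dvdn_mull.
  by move=> _; apply: dvdz_exp_le w1; rewrite leq_addl.
have [Cw|nCw] := pselect (C w).
  have [|z [[_ nCz] Cz]] := wy C; last by [].
  by apply/nbhs_golombP; have := oC w Cw.
have [|z [Cz [_ nCz]]] := wx (nonmultiples p `\` C); last by [].
by apply/nbhs_golombP; have := oC' w (conj pw nCw).
Qed.

Lemma open_residue p n (x : GZ) : prime p -> (0 < n)%N ->
  ~~ (p %|| val x) -> open (progression x (p ^ n)).
Proof.
move=> pp n0 px; apply: open_progression.
  by rewrite expn_gt0 prime_gt0.
by rewrite coprimezE coprimeXr // coprime_sym prime_coprime.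
Qed.

Lemma quasiclosure_padic p (B : set int) (x : GZ) : prime p ->
  relative_quasiclosure (nonmultiples p) (val @^-1` B) x <->
  padic_closure p B (val x).
Proof.
move=> pp; split=> [[px H]|[px H]]; split=> //.
  move=> n; have pz z : progression x (p ^ n.+1) z -> nonmultiples p z.
    rewrite /nonmultiples /= => hz; apply: contra px => pz.
    have : p %|| val z - val x.
      by apply: dvdz_trans hz; rewrite dvdzE /= dvdn_exp.
    by move=> /(rpredB pz); rewrite subKr.
  have [||||a [Ba /= ha]] := H (progression x (p ^ n.+1)).
  - exact: open_residue.
  - rewrite openE => z [oz nz].
    apply: (@filterS _ _ _ (progression z (p ^ n.+1))).
      move=> w hw; split.
        rewrite /nonmultiples /=; apply: contra oz => pw.
        have : p %|| val w - val z.
          by apply: dvdz_trans hw; rewrite dvdzE /= dvdn_exp.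
        by move=> /(rpredB pw); rewrite subKr.
      move=> wx; apply: nz; rewrite /progression /=.
      have -> : val z - val x = (val w - val x) - (val w - val z) by ring.
      exact: rpredB.
    apply: open_nbhs_nbhs; split; first exact: open_residue.
    by rewrite /progression /= subrr dvdz0.
  - exact: pz.
  - by rewrite /progression /= subrr dvdz0.
  by exists (val a) => //; apply: dvdz_exp_le ha.
move=> C oC oOC sC Cx.
have [n sn] := relclopen_padic pp oC oOC sC Cx.
have [a Ba ha] := H n.+1.
have a0 : a != 0.
  apply: contraTneq ha => ->; rewrite sub0r rpredN.
  by apply: contra px; apply: dvdz_trans; rewrite dvdzE /= dvdn_exp.
have [A eA] := exists_val a0.
exists A; split; first by rewrite /= eA.
by apply: sn; rewrite /progression /= eA; apply: dvdz_exp_le ha.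
Qed.

(** [f] maps the nonzero elements of [B] onto those of [B'].  Working with such
pairs of sets of integers avoids direct images of sets of points. *)
Definition set_match (f : GZ -> GZ) (B B' : set int) :=
  forall x, B (val x) <-> B' (val (f x)).

Lemma set_match_sym (f g : GZ -> GZ) B B' : homeo_pair f g ->
  set_match f B B' -> set_match g B' B.
Proof. by move=> [_ _ _ gK] H x; rewrite H gK. Qed.

Lemma set_matchI (f : GZ -> GZ) A A' B B' : set_match f A A' ->
  set_match f B B' -> set_match f (A `&` B) (A' `&` B').
Proof. by move=> hA hB x; split=> -[/hA ? /hB ?]. Qed.

Lemma set_match_padic (f g : GZ -> GZ) p p' B B' : homeo_pair f g -> prime p ->
    prime p' -> prime_match f p p' -> set_match f B B' ->
  set_match f (padic_closure p B) (padic_closure p' B').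
Proof.
move=> fg; wlog suff : f g fg p p' B B' / prime p -> prime p' ->
    prime_match f p p' -> set_match f B B' -> forall x,
    padic_closure p B (val x) -> padic_closure p' B' (val (f x)).
  move=> H pp pp' fp fB x; split; first exact: (H f g fg).
  move=> h; have [_ _ fK _] := fg; rewrite -(fK x).
  apply: (H g f (homeo_pairC fg) p' p B' B) h => //.
  - exact: prime_match_sym fp.
  - exact: set_match_sym fB.
move=> pp pp' fp fB x /(quasiclosure_padic _ _ pp) h.
apply/(quasiclosure_padic _ _ pp'); apply: (quasiclosure_homeo fg).
have -> : f @^-1` nonmultiples p' = nonmultiples p.
  by rewrite predeqE => y; rewrite /nonmultiples /= fp.
have -> // : f @^-1` (val @^-1` B') = val @^-1` B.
by rewrite predeqE => y; rewrite /= fB.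
Qed.

Lemma set_match_sub (f g : GZ -> GZ) A A' B B' : homeo_pair f g ->
    set_match f A A' -> set_match f B B' -> ~ A' 0 ->
  A `<=` B -> A' `<=` B'.
Proof.
move=> [_ _ _ gK] fA fB A0 AB y A'y.
have [|Y eY] := @exists_val y; first by apply: contra_notN A0 => /eqP <-.
by rewrite -eY -(gK Y) -fB; apply: AB; rewrite fA gK eY.
Qed.

Lemma padic_closure0 p A : ~ padic_closure p A 0.
Proof. by rewrite /padic_closure /= dvdz0 => -[]. Qed.

Lemma set_match_prime_powers (f g : GZ -> GZ) q q' : homeo_pair f g -> prime q ->
  prime q' -> prime_match f q q' ->
  set_match f (prime_powers q) (prime_powers q').
Proof.
move=> fg; have gf := homeo_pairC fg.
move=> pq pq' fq x; split=> H r pr.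
  have [s ps gs] := exists_prime_match gf pr.
  have fs := prime_match_sym gf gs.
  rewrite -fs H //; apply/eqP/eqP => e.
    by rewrite e in fs; apply: prime_match_inj fg pr pq' fs fq.
  by rewrite e in gs; apply: prime_match_inj gf ps pq gs (prime_match_sym fg fq).
have [s ps fs] := exists_prime_match fg pr.
rewrite fs H //; apply/eqP/eqP => e.
  have gs := prime_match_sym fg fs; rewrite e in gs.
  exact: prime_match_inj gf pr pq gs (prime_match_sym fg fq).
by rewrite e in fs; apply: prime_match_inj fg ps pq' fs fq.
Qed.

(** * Levels are preserved *)

Lemma set_match_padic_group (f g : GZ -> GZ) p p' q q' : homeo_pair f g ->
    prime p -> prime p' -> prime q -> prime q' ->
    prime_match f p p' -> prime_match f q q' ->
  set_match f (padic_group p q) (padic_group p' q').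
Proof.
move=> fg pp pp' pq pq' fp fq; apply: (set_match_padic fg) => //.
exact: set_match_prime_powers fg _ _ _.
Qed.

Lemma chainlike_match (f g : GZ -> GZ) p p' q q' : homeo_pair f g ->
    prime p -> prime p' -> prime q -> prime q' ->
    prime_match f p p' -> prime_match f q q' ->
  chainlike p q -> chainlike p' q'.
Proof.
move=> fg pp pp' pq pq' fp fq chain q1' q2' P' r' pq1' pq2' pP' pr'.
have gf := homeo_pairC fg.
have inv s' : prime s' -> exists2 s, prime s & prime_match f s s'.
  move=> /(exists_prime_match gf)[s ps gs]; exists s => //.
  exact: prime_match_sym gs.
have [q1 pq1 fq1] := inv _ pq1'; have [q2 pq2 fq2] := inv _ pq2'.
have [P pP fP] := inv _ pP'; have [r pr fr] := inv _ pr'.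
have neq s s' t t' : prime s' -> prime t' -> prime_match f s s' ->
    prime_match f t t' -> s' != t' -> s != t.
  move=> ps pt fs ft; apply: contraNneq => e; apply/eqP.
  by rewrite e in fs; apply: prime_match_inj fg ps pt fs ft.
move=> /(neq _ _ _ _ pq1' pp' fq1 fp) n1 /(neq _ _ _ _ pq2' pp' fq2 fp) n2.
move=> /(neq _ _ _ _ pq2' pP' fq2 fP) n3 /(neq _ _ _ _ pr' pP' fr fP) n4.
have mK := set_match_padic_group fg pp pp' pq pq' fp fq.
have mK1 := set_match_padic_group fg pp pp' pq1 pq1' fp fq1.
have mE : set_match f (padic_group_trace p q2 P r) (padic_group_trace p' q2' P' r').
  apply: (set_match_padic fg) => //; apply: set_matchI.
    exact: (set_match_prime_powers fg).
  exact: (set_match_padic_group fg).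
move=> h1 h2.
have h1' := set_match_sub gf (set_match_sym fg mK1) (set_match_sym fg mK)
  (@padic_closure0 _ _) h1.
have h2' := set_match_sub gf (set_match_sym fg mE) (set_match_sym fg mK)
  (@padic_closure0 _ _) h2.
have [h|h] := chain q1 q2 P r pq1 pq2 pP pr n1 n2 n3 n4 h1' h2'; [left|right].
  exact: (set_match_sub fg mK1 mE (@padic_closure0 _ _) h).
exact: (set_match_sub fg mE mK1 (@padic_closure0 _ _) h).
Qed.

Lemma near1_match (f g : GZ -> GZ) p p' k : homeo_pair f g ->
    prime p -> prime p' -> prime_match f p p' -> (base_level p <= k)%N ->
  exists2 k', (base_level p' <= k')%N &
    set_match f [set x | near1 p k x] [set x | near1 p' k' x].
Proof.
move=> fg pp pp' fp hk.
have [q [pq qp eK]] := exists_padic_group_near1 pp hk.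
have [q' pq' fq] := exists_prime_match fg pq.
have qp' : q' != p'.
  apply: contraNneq qp => e; apply/eqP; rewrite e in fq.
  exact: prime_match_inj (homeo_pairC fg) pq pp (prime_match_sym fg fq)
    (prime_match_sym fg fp).
have chain := chainlike_match fg pp pp' pq pq' fp fq (near1_chainlike pp hk eK).
have [k' hk' eK'] := chainlike_near1 pp' pq' qp' chain.
exists k' => //; rewrite -eK -eK'.
exact: (set_match_padic_group fg).
Qed.

Lemma near1_lt p j k : prime p -> (base_level p <= j)%N ->
  [set x | near1 p j x] `<=` [set x | near1 p k x] -> (k <= j)%N.
Proof.
move=> pp hj sub; rewrite leqNgt; apply/negP => jk.
have [r [_ rj rjN]] := exists_prime_level pp hj.
by case/negP: rjN; apply: near1_le jk _; apply: sub.
Qed.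

Lemma near1_not0 p k : prime p -> (base_level p <= k)%N -> ~~ near1 p k 0.
Proof.
move=> pp hk; apply/negP => /(near1_ndvd pp (leq_trans (base_level_gt0 p) hk)).
by rewrite dvdz0.
Qed.

(** The levels matched with [0, 1, ..., i] form a strictly increasing
sequence. *)
Lemma near1_match_le (f g : GZ -> GZ) p p' i j : homeo_pair f g ->
    prime p -> prime p' -> prime_match f p p' ->
    set_match f [set x | near1 p (base_level p + i) x]
                [set x | near1 p' (base_level p' + j) x] ->
  (i <= j)%N.
Proof.
move=> fg pp pp' fp; elim: i j => // i IH j mj.
have [k' hk' mk] := near1_match fg pp pp' fp (leq_addr i (base_level p)).
rewrite -(subnKC hk') in mk.
apply: leq_ltn_trans (IH _ mk) _; rewrite ltnNge; apply/negP => le.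
have sub : [set x | near1 p' (base_level p' + (k' - base_level p')) x] `<=`
           [set x | near1 p' (base_level p' + j) x].
  by move=> x; apply: near1_le; rewrite leq_add2l.
have n0 : ~ [set x | near1 p (base_level p + i) x] 0.
  by apply/negP/near1_not0 => //; apply: leq_addr.
have := near1_lt pp (leq_addr _ _) (set_match_sub (homeo_pairC fg)
  (set_match_sym fg mk) (set_match_sym fg mj) n0 sub).
by rewrite addnS ltnn.
Qed.

(** Apply [near1_match_le] to [f] and to its inverse. *)
Lemma near1_match_level (f g : GZ -> GZ) p p' i : homeo_pair f g ->
    prime p -> prime p' -> prime_match f p p' ->
  set_match f [set x | near1 p (base_level p + i) x]
              [set x | near1 p' (base_level p' + i) x].
Proof.
move=> fg pp pp' fp; have gf := homeo_pairC fg.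
have [k' hk' mk] := near1_match fg pp pp' fp (leq_addr i (base_level p)).
rewrite -(subnKC hk') in mk.
have le := near1_match_le fg pp pp' fp mk.
have ge := near1_match_le gf pp' pp (prime_match_sym fg fp) (set_match_sym fg mk).
have e : (k' - base_level p')%N = i by apply/eqP; rewrite eqn_leq le ge.
by rewrite e in mk.
Qed.

Lemma near1_sqr p k (x : int) : prime p -> odd p ->
  near1 p k x = ((p ^ k)%N %|| x ^+ 2 - 1).
Proof.
move=> pp op; have -> : x ^+ 2 - 1 = (x - 1) * (x + 1) by ring.
case: k => [|k]; first by rewrite /near1 expn0 !dvd1z.
apply/orP/idP => [[h|h]|h]; [exact: dvdz_mulr|exact: dvdz_mull|].
have [p1|p1] := boolP (p %|| x - 1).
  left; rewrite -(Gauss_dvdzl _ (_ : coprimez _ (x + 1))) //.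
  rewrite coprimezE coprimeXl // prime_coprime //; apply/negP => p2.
  have : p %|| (x + 1) - (x - 1) by exact: rpredB.
  have -> : (x + 1) - (x - 1) = 2 by ring.
  rewrite dvdzE /= dvdn_prime2 // => /eqP e; by rewrite e in op.
right; rewrite -(Gauss_dvdzr _ (_ : coprimez _ (x - 1))) //.
by rewrite coprimezE coprimeXl // prime_coprime.
Qed.

(** One of [x - 1] and [x + 1] is twice an odd number when [x] is odd, whence the
shift by one. *)
Lemma near1_sqr2 k (x : int) : near1 2 k.+2 x = ((2 ^ k.+3)%N %|| x ^+ 2 - 1).
Proof.
have -> : x ^+ 2 - 1 = (x - 1) * (x + 1) by ring.
have [x2|x2] := boolP (2 %|| x - 1); last first.
  have x2' : ~~ (2 %|| x + 1) by move: x2; lia.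
  transitivity false.
    by apply/negbTE/norP; split; [apply: contra x2|apply: contra x2'];
      apply: dvdz_trans; rewrite dvdzE /= dvdn_exp.
  apply/esym/negbTE; apply: contra x2 => h.
  have : 2 %|| (x - 1) * (x + 1) by apply: dvdz_trans h; rewrite dvdzE /= dvdn_exp.
  by rewrite dvdzE abszM Euclid_dvdM // => /orP[//|]; rewrite -[(_ %| _)%N]/(2 %|| x + 1) (negPf x2').
have /dvdzP[y ey] := x2.
have -> : x = 1 + 2 * y by move: ey; move: (x) => z; lia.
rewrite /near1 !dvdz_expE.
have -> : 1 + 2 * y - 1 = 2 * y by ring.
have -> : 1 + 2 * y + 1 = 2 * (y + 1) by ring.
have -> : 2 * y * (2 * (y + 1)) = 2 * (2 * (y * (y + 1))) by ring.
rewrite !(exprS _ k.+2) (exprS _ k.+1) !dvdz_mul2l //.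
(* of the two consecutive integers [y] and [y + 1] one is odd *)
have [y2|y2] := boolP (2 %|| y).
  have h : ~~ (2 %|| y + 1) by move: y2; lia.
  have c : coprimez (2 ^+ k.+1) (y + 1).
    by rewrite coprimezE abszX coprimeXl // prime_coprime.
  rewrite Gauss_dvdzl //; case: (boolP (_ %| y)%Z) => //= _.
  apply/negbTE; apply: contra h; apply: dvdz_trans.
  by rewrite exprS dvdz_mulr.
have c : coprimez (2 ^+ k.+1) y.
  by rewrite coprimezE abszX coprimeXl // prime_coprime.
rewrite Gauss_dvdzr //; case: (boolP (_ %| y + 1)%Z) => /=; rewrite ?orbT ?orbF //.
move=> _; apply/negbTE; apply: contra y2; apply: dvdz_trans.
by rewrite exprS dvdz_mulr.
Qed.

(** * Primes are fixed *)

Lemma near1_match_eq (f g : GZ -> GZ) p p' i x : homeo_pair f g ->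
    prime p -> prime p' -> prime_match f p p' ->
  near1 p (base_level p + i) (val x) = near1 p' (base_level p' + i) (val (f x)).
Proof.
by move=> fg pp pp' fp; apply/idP/idP => /(near1_match_level i fg pp pp' fp x).
Qed.

Lemma odd_prime_base p : odd p -> base_level p = 1%N.
Proof. by rewrite /base_level; case: eqP => // ->. Qed.

(** At [2] and [3] every number prime to the prime is close to [1] or [-1]
([near1_small]); at a larger prime, [2] is not. *)
Lemma prime_match_small (f g : GZ -> GZ) p p' : homeo_pair f g ->
    prime p -> prime p' -> prime_match f p p' -> (p <= 3)%N -> (p' <= 3)%N.
Proof.
move=> fg pp pp' fp p3; rewrite leqNgt; apply/negP => p'3.
have [X eX] : exists X : GZ, val X = 2 by apply: exists_val.
case: (fg) => _ _ _ gK.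
have nX : ~~ (p' %|| val (f (g X))).
  by rewrite gK eX dvdzE /=; apply/negP => /dvdn_leq; lia.
have := near1_match_eq 0 (g X) fg pp pp' fp.
rewrite !addn0 near1_small // ?fp // gK eX /base_level.
have -> : (p' == 2)%N = false by lia.
move=> /esym /orP[]; rewrite expn1 dvdzE /= => /dvdn_leq; lia.
Qed.

Lemma eq_logn p m n : prime p -> (0 < m)%N -> (0 < n)%N ->
  (forall k, (p ^ k %| m)%N = (p ^ k %| n)%N) -> logn p m = logn p n.
Proof.
move=> pp m0 n0 H; apply/eqP; rewrite eqn_leq -!pfactor_dvdn //.
by rewrite -H pfactor_dvdnn H pfactor_dvdnn.
Qed.

(** Otherwise [2] and [3] are exchanged, and [f 4] is a power [A] of [3] up to
sign.  As [4 ^ 2 - 1 = 3 * 5] with [4] of level exactly [1] at [3], the number [A]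
has exact level [2] at [2], and the only odd prime at which it is close to [1] or
[-1] is the image [s] of [5].  So [A - 1] and [A + 1] are twice and four times an
odd number, up to order, and [s] is the only odd prime that may divide them; it does
not divide both.  One of the odd parts is then [1], which forces [A = 3], whereas
[s] divides neither [2] nor [4]. *)
Lemma prime_match2 (f g : GZ -> GZ) : homeo_pair f g -> prime_match f 2 2.
Proof.
move=> fg; have gf := homeo_pairC fg; have p2 : prime 2 by []; have p3 : prime 3 by [].
have [q pq fq] := exists_prime_match fg p2.
have := prime_match_small fg p2 pq fq isT.
case: q pq fq => [|[|[|[|]]]] // _ f23 _; exfalso.
have inj := prime_match_inj fg.
have [q3 pq3 fq3] := exists_prime_match fg p3.
have f32 : prime_match f 3 2.
  have := prime_match_small fg p3 pq3 fq3 isT.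
  case: q3 pq3 fq3 => [|[|[|[|]]]] // _ f33 _.
  have := prime_match_inj gf p2 p3 (prime_match_sym fg f23) (prime_match_sym fg f33).
  by [].
have p5 : prime 5 by [].
have [s ps f5s] := exists_prime_match fg p5.
have s2 : s != 2%N.
  apply/eqP => e; rewrite e in f5s.
  by have := prime_match_inj gf p5 p3 (prime_match_sym fg f5s) (prime_match_sym fg f32).
have os : odd s by case: (even_prime ps) s2 => // ->.
have [X eX] : exists X : GZ, val X = 4 by apply: exists_val.
have : prime_powers 3 (val (f X)).
  apply/(set_match_prime_powers fg p2 p3 f23 X); rewrite eX.
  by move=> r pr; rewrite (_ : 4 = 2%:Z ^+ 2) // prime_dvdzX // dvdzE /= dvdn_prime2.
move=> /(prime_powersE p3)[m em].
pose A := (3 ^ m.+1)%N.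
have eA p k : near1 p k (val (f X)) = near1 p k A%:Z.
  by rewrite /A PoszX; case: em => ->; rewrite ?near1N.
have h2 : near1 2 2 A.
  by have := near1_match_eq 0 X fg p3 p2 f32; rewrite eX eA => <-.
have h2N : ~~ near1 2 3 A.
  by have := near1_match_eq 1 X fg p3 p2 f32; rewrite eX eA => <-.
have hs : near1 s 1 A.
  have := near1_match_eq 0 X fg p5 ps f5s; rewrite eX eA (odd_prime_base os) => <-.
  by [].
have A3 : (3 %| A)%N by rewrite dvdn_exp.
have ht t : prime t -> t != 2%N -> near1 t 1 A -> t = s.
  move=> pt t2 hA; apply/eqP; apply: contraLR hA => ts; rewrite -eA.
  have ot : odd t by case: (even_prime pt) t2 => // ->.
  have [r pr gr] := exists_prime_match gf pt; have fr := prime_match_sym gf gr.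
  have r3 : r != 3%N.
    by apply: contraNneq t2 => e; rewrite e in fr; rewrite (inj _ _ _ pt p2 fr f32).
  have r5 : r != 5%N.
    by apply: contraNneq ts => e; rewrite e in fr; rewrite (inj _ _ _ pt ps fr f5s).
  have [r2|r2] := eqVneq r 2%N.
    rewrite r2 in fr; rewrite (inj _ _ _ pt p3 fr f23) eA.
    by apply/negP => /(near1_ndvd p3 (ltn0Sn 0)); rewrite dvdzE /= A3.
  have or : odd r by case: (even_prime pr) r2 => // ->.
  have := near1_match_eq 0 X fg pr pt fr; rewrite !odd_prime_base // eX => <-.
  by rewrite /near1 expn1; apply/norP; split; rewrite dvdzE /= dvdn_prime2.
have A3' : A <> 3%N.
  move=> e; move: hs; rewrite e /near1 expn1 !dvdzE /= => /orP[].
    by rewrite dvdn_prime2 // (negPf s2).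
  by rewrite (Euclid_dvdX 2 2) // dvdn_prime2 // (negPf s2).
have A1 : (1 < A)%N by rewrite (leq_trans _ (dvdn_leq _ A3)) // expn_gt0.
(* a divisor of [A - 1] or [A + 1] which is neither even nor divisible by [s] *)
have one u : odd u -> ~~ (s %| u)%N -> (u %| A.-1)%N || (u %| A.+1)%N -> u = 1%N.
  move=> ou su uA; apply/eqP; apply: contraT => u1.
  have pp : prime (pdiv u) by rewrite pdiv_prime //; case: u u1 ou {su uA} => [|[]].
  have du := pdiv_dvd u; case/negP: su; rewrite -(ht (pdiv u)) //.
    by apply: contraTneq ou => e; rewrite -dvdn2 -e.
  rewrite /near1 expn1; case/orP: uA => h; apply/orP; [left|right].
    by rewrite -predn_int ?(ltnW A1) //; apply: dvdn_trans du h.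
  by rewrite -PoszD addn1; apply: dvdn_trans du h.
have sdiff : ~~ ((s %| A.-1)%N && (s %| A.+1)%N).
  apply/negP => /andP[h1 h2']; have := dvdn_sub h2' h1.
  have -> : (A.+1 - A.-1 = 2)%N by move: A1; clear; case: A => //; lia.
  by rewrite dvdn_prime2 // (negPf s2).
have [u [v [ou ov uv]]] : exists u v, [/\ odd u, odd v &
    (A.-1 = 2 * u /\ A.+1 = 4 * v)%N \/ (A.-1 = 4 * u /\ A.+1 = 2 * v)%N].
  have h8 : (A %% 8 = 3)%N \/ (A %% 8 = 5)%N.
    move: h2 h2N; rewrite /near1 (_ : 2 ^ 2 = 4)%N // (_ : 2 ^ 3 = 8)%N //.
    by move: A1; clear; move: (A) => B; lia.
  move: h8 A1; clear; move: (A) => B h8 B1.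
  by case: h8 => h8; [exists B.-1./2, (B.+1 %/ 4)%N|exists (B.-1 %/ 4)%N, B.+1./2];
    split; lia.
have uA : (u %| A.-1)%N by case: uv => -[-> _]; rewrite dvdn_mull.
have vA : (v %| A.+1)%N by case: uv => -[_ ->]; rewrite dvdn_mull.
have : u = 1%N \/ v = 1%N.
  have [su|su] := boolP (s %| u)%N; [right|left]; apply: one => //.
  - apply: contra sdiff => sv.
    by rewrite (dvdn_trans su uA) (dvdn_trans sv vA).
  - by rewrite vA orbT.
  - by rewrite uA.
move: A3 A3' uv A1; clear; move: (A) => B B3 B3' uv B1 [e|e]; rewrite e in uv; lia.
Qed.

Lemma absz_eq_of_sqr (x y : int) : x ^+ 2 = y ^+ 2 -> absz x = absz y.
Proof. by move/eqP; rewrite eqf_sqr => /orP[] /eqP ->; rewrite ?abszN. Qed.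

Lemma sqr_sub1_gt0 (x : int) : x != 0 -> absz x != 1%N -> 0 < x ^+ 2 - 1.
Proof.
move=> x0 x1; have : (x <= -2) || (2 <= x) by lia.
have -> : x ^+ 2 - 1 = (x - 1) * (x + 1) by ring.
by case/orP => h; [rewrite nmulr_rgt0; lia|rewrite pmulr_rgt0; lia].
Qed.

(** At a prime not dividing [x ^ 2 - 1] nothing is known about the image of the
prime, but a prime dividing [f x ^ 2 - 1] is the image of one dividing
[x ^ 2 - 1], which is its own image.  So the two numbers have the same
valuations. *)
Lemma prime_match_fixed (f g : GZ -> GZ) (x : GZ) : homeo_pair f g ->
    (forall p, prime p -> odd p -> p %|| val x ^+ 2 - 1 -> prime_match f p p) ->
  absz (val (f x)) = absz (val x).
Proof.
move=> fg H; have gf := homeo_pairC fg; have f22 := prime_match2 fg.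
have p2 : prime 2 by [].
have [x1|x1] := eqVneq (absz (val x)) 1%N.
  by rewrite x1; apply: (homeo_unit fg).
have fx1 : absz (val (f x)) != 1%N.
  by apply: contraNneq x1 => /(homeo_unit gf); case: fg => _ _ -> _ ->.
have D0 := sqr_sub1_gt0 (valP x) x1; have D0' := sqr_sub1_gt0 (valP (f x)) fx1.
have key p k : prime p ->
    ((p ^ k)%N %|| val x ^+ 2 - 1) = ((p ^ k)%N %|| val (f x) ^+ 2 - 1).
  move=> pp; have [->|p2'] := eqVneq p 2%N.
    have [ev|od] := boolP (2 %|| val x).
      have ndvd y : 2 %|| y -> ((2 ^ k)%N %|| y ^+ 2 - 1) = (k == 0%N).
        case: k => [|k] hy; first by rewrite dvd1z.
        apply/negbTE; apply/negP => h.
        have h1 : 2 %|| y ^+ 2 - 1.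
          by apply: dvdz_trans h; rewrite dvdzE /= dvdn_exp.
        have : 2 %|| y ^+ 2 by rewrite dvdz_exp.
        by move=> /rpredB /(_ h1); rewrite subKr.
      by rewrite !ndvd // -f22.
    have lo y : ~~ (2 %|| y) -> (k <= 3)%N -> (2 ^ k)%N %|| y ^+ 2 - 1.
      move=> y2 k3; apply: dvdz_exp_le k3 _; rewrite -(near1_sqr2 0).
      exact: (near1_small p2).
    case: (leqP k 3) => k3; first by rewrite !lo // -f22.
    have -> : k = (k - 3).+3 by rewrite -addn3 subnK // ltnW.
    by rewrite -!near1_sqr2 -(near1_match_eq (k - 3) x fg p2 p2 f22).
  have op : odd p by case: (even_prime pp) p2' => // ->.
  case: k => [|k]; first by rewrite !dvd1z.
  rewrite -!near1_sqr //.
  have [fpp|fpp] := pselect (prime_match f p p).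
    by have := near1_match_eq k x fg pp pp fpp; rewrite odd_prime_base.
  transitivity false.
    apply/negbTE/negP => h; apply/fpp/H => //.
    by rewrite -(expn1 p) -near1_sqr //; apply: near1_le h.
  apply/esym/negbTE/negP => h; apply: fpp.
  have [r pr gr] := exists_prime_match gf pp; have fr := prime_match_sym gf gr.
  have r2 : r != 2%N.
    apply: contraNneq p2' => e; rewrite e in fr; apply/eqP.
    exact: prime_match_inj fg pp p2 fr f22.
  have or : odd r by case: (even_prime pr) r2 => // ->.
  have frr : prime_match f r r.
    apply: H => //; rewrite -(expn1 r) -near1_sqr //.
    have := near1_match_eq 0 x fg pr pp fr; rewrite !odd_prime_base // => ->.
    exact: near1_le h.
  by rewrite -(prime_match_inj fg pr pp frr fr) .
apply: absz_eq_of_sqr; apply: (addIr (-1)).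
rewrite -(gtz0_abs D0) -(gtz0_abs D0'); congr Posz.
apply: eqn_from_log; [by rewrite absz_gt0 gt_eqF|by rewrite absz_gt0 gt_eqF|].
move=> p; have [pp|pp] := boolP (prime p); last first.
  by rewrite lognE (negPf pp) /= lognE (negPf pp).
apply: eq_logn => //; [by rewrite absz_gt0 gt_eqF|by rewrite absz_gt0 gt_eqF|].
by move=> k; have := key p k pp; rewrite !dvdzE.
Qed.

(** All prime divisors of [p ^ 2 - 1] are smaller than the odd prime [p]. *)
Lemma prime_match_refl (f g : GZ -> GZ) p : homeo_pair f g -> prime p ->
  prime_match f p p.
Proof.
move=> fg; elim/ltn_ind: p => p IH pp.
have [->|p2] := eqVneq p 2%N; first exact: prime_match2 fg.
have op : odd p by case: (even_prime pp) p2 => // ->.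
have [X eX] : exists X : GZ, val X = p%:Z.
  by apply: exists_val; have := prime_gt0 pp; lia.
have fX : absz (val (f X)) = p.
  rewrite (prime_match_fixed fg) ?eX // => r pr or h; apply: IH => //.
  have rp : (r %| (p.-1 * p.+1))%N.
    move: h; have -> : p%:Z ^+ 2 - 1 = (p.-1 * p.+1)%N%:Z.
      by rewrite PoszM predn_int ?prime_gt0 // intS; ring.
    by [].
  have p1 := prime_gt1 pp.
  (* [p + 1] is even and larger than 2, hence not prime *)
  have rp1 : r != p.+1.
    by apply: contraTneq or => ->; rewrite /= op.
  have rp0 : r != p.
    apply/eqP => e; rewrite e in h; have hp : p %|| p%:Z ^+ 2 by rewrite dvdz_exp.
    have := rpredB hp h; rewrite subKr dvdzE /= dvdn1 => /eqP e1.
    by rewrite e1 in p1.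
  have rle : (r <= p.+1)%N.
    move: rp; rewrite Euclid_dvdM // => /orP[] /dvdn_leq; last exact.
    move=> h'; apply: leq_trans (leqW (leq_pred p)); apply: h'.
    by rewrite -subn1 subn_gt0.
  by rewrite ltn_neqAle rp0 -ltnS ltn_neqAle rp1.
have [q pq fq] := exists_prime_match fg pp.
have := fq X; rewrite eX dvdzz => /esym; rewrite dvdzE fX /= dvdn_prime2 //.
by move=> /eqP e; rewrite e in fq.
Qed.

Lemma homeo_absz (f g : GZ -> GZ) (x : GZ) : homeo_pair f g ->
  absz (val (f x)) = absz (val x).
Proof.
by move=> fg; apply: (prime_match_fixed fg) => p pp _ _; apply: (prime_match_refl fg).
Qed.

(** * The sign is constant *)

(** Connectedness: the product [n * m] lies in the closures of [x + nZ] and of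
[y + mZ]. *)
Lemma clopen_setT (C : set GZ) (x : GZ) : open C -> open (~` C) -> C x ->
  forall y, C y.
Proof.
move=> oC oC' Cx y; apply: contrapT => nCy.
have /open_golombP/(_ x Cx)[n [n0 cn sn]] := oC.
have /open_golombP/(_ y nCy)[m [m0 cm sm]] := oC'.
have [w ew] : exists w : GZ, val w = (n * m)%N%:Z.
  by apply: exists_val; rewrite -lt0n muln_gt0 n0.
have cl z k : (0 < k)%N -> (k %| n * m)%N -> closure (progression z k) w.
  move=> k0 knm; apply/closure_progressionP => // p [|i] pp pik.
    by rewrite expn0 dvd1z orbT.
  rewrite ew dvdzE /= (dvdn_trans _ knm) // (dvdn_trans _ pik) //.
  by rewrite expnS dvdn_mulr.
have clC : closure C w by apply: closure_subset sn _ (cl x n n0 (dvdn_mulr _ _)).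
have clC' : closure (~` C) w.
  by apply: closure_subset sm _ (cl y m m0 (dvdn_mull _ _)).
have [Cw|nCw] := pselect (C w).
  by have [z []] := clC' C (open_nbhs_nbhs (conj oC Cw)).
by have [z []] := clC (~` C) (open_nbhs_nbhs (conj oC' nCw)).
Qed.

(** Choose a prime [r] not dividing [2 * x].  If [z = x] and [f z = f x] modulo
[r], the signs at [x] and [z] agree, as otherwise [r] would divide [2 * x]. *)
Lemma homeo_sign_open (f g : GZ -> GZ) (e : int) : homeo_pair f g ->
  absz e = 1%N -> open [set x : GZ | val (f x) = e * val x].
Proof.
move=> fg e1; rewrite openE => x ex'.
have ex : val (f x) = e * val x := ex'.
have [r rx pr] := prime_above (2 * absz (val x)).
have r0 := prime_gt0 pr.
have ndvd2 : ~~ (r %|| 2 * val x).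
  rewrite dvdzE abszM /=; apply/negP => /dvdn_leq.
  by rewrite muln_gt0 absz_gt0 (valP x) => /(_ isT); rewrite leqNgt rx.
have rx' : ~~ (r %|| val x) by apply: contra ndvd2; apply: dvdz_mull.
have cop (y : GZ) : absz (val y) = absz (val x) -> coprimez (val y) r.
  move=> ey; rewrite coprimezE ey coprime_sym prime_coprime //.
have near_f : nbhs x (f @^-1` progression (f x) r).
  apply: (hp_cont fg); apply: nbhs_progression => //.
  by apply: cop; apply: homeo_absz fg.
have near_x := nbhs_progression r0 (cop x erefl).
apply: filterS (filterI near_f near_x) => z [/= hf hz].
have e0 : e = 1 \/ e = -1 by move: e1; clear; lia.
have : val (f z) = e * val z \/ val (f z) = - (e * val z).
  move: (homeo_absz z fg) e0; move: (val (f z)) (val z) => a b; clear => h.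
  by case=> ->; move: h; lia.
case=> // ez; case/negP: ndvd2; rewrite /progression /= in hf.
have : r %|| e * (val z - val x) by rewrite dvdz_mull.
have : r %|| val (f z) - val (f x) := hf.
rewrite ez ex => h1 /(rpredD h1).
have -> : - (e * val z) - e * val x + e * (val z - val x) = - (e * (2 * val x)).
  by ring.
by rewrite rpredN !dvdzE abszM e1 mul1n.
Qed.

Lemma continuous_opp (f : GZ -> GZ) :
  (forall x, val (f x) = - val x) -> continuous f.
Proof.
move=> fE x U /nbhs_golombP[n [n0 cn sn]]; apply/nbhs_golombP.
exists n; split=> //.
  by move: cn; rewrite fE !coprimezE abszN.
move=> z hz; apply: sn; rewrite /progression /= !fE.
by rewrite -opprD rpredN.
Qed.

Theorem theorem6p7 (f : golomb int -> golomb int) :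
  homeomorphism f <->
    (forall x, f x = x) \/ (forall x, val (f x) = -1 * val x).
Proof.
split=> [[cf [g [fK gK cg]]]|[fE|fE]].
- have fg : homeo_pair f g by split.
  have compl : ~` [set x : GZ | val (f x) = 1 * val x] =
               [set x : GZ | val (f x) = -1 * val x].
    rewrite predeqE => x; have := homeo_absz x fg.
    have x0 : val x != 0 := valP x.
    suff H (a b : int) : b != 0 -> absz a = absz b -> ~ (a = 1 * b) <-> a = -1 * b.
      exact: H x0.
    by clear; lia.
  have o1 := @homeo_sign_open f g 1 fg erefl.
  have oN1 := @homeo_sign_open f g (-1) fg erefl.
  have [[x hx]|no] := pselect (exists x : GZ, val (f x) = 1 * val x).
    left=> y; apply: val_inj; rewrite -[RHS]mul1r.
    by apply: (@clopen_setT [set x : GZ | val (f x) = 1 * val x] x); rewrite ?compl.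
  right=> x; suff : (~` [set x : GZ | val (f x) = 1 * val x]) x by rewrite compl.
  by move=> hx; apply: no; exists x.
- have -> : f = id by apply/funext.
  by split; [move=> x U|exists id; split=> // x U].
have {}fE x : val (f x) = - val x by rewrite fE mulN1r.
have ff : cancel f f by move=> x; apply: val_inj; rewrite !fE opprK.
have cf := continuous_opp fE.
by split=> //; exists f; split.
Qed.
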